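(* Let $X=(X_t)_{t\ge 0}$ be a real-valued Lévy process. For all $\lambda,\mu>0$ and all $x>0$, $$E\left[\exp\left(-\lambda T_{[x,+\infty[}-\mu X_{T_{[x,+\infty[}}\right)\right]=\frac{E\left[e^{-\mu S_{\mathbf e_\lambda}}1_{\{S_{\mathbf e_\lambda}\ge x\}}\right]}{E\left[e^{-\mu S_{\mathbf e_\lambda}}\right]}.$$
   Context: $X$ has càdlàg paths and $X_0=0$. For $t\ge 0$, $S_t=\sup_{0\le s\le t}X_s$. For $x>0$, $T_{[x,+\infty[}=\inf\{s>0: X_s\ge x\}$ (with $\inf\emptyset=+\infty$), and the expression $\exp(-\lambda T_{[x,+\infty[}-\mu X_{T_{[x,+\infty[}})$ is taken to be $0$ on the event $\{T_{[x,+\infty[}=+\infty\}$. For $\lambda>0$, $\mathbf e_\lambda$ is an exponential random variable with parameter $\lambda$ (mean $1/\lambda$), independent of $X$, and $S_{\mathbf e_\lambda}$ is the running supremum $S$ evaluated at the time $\mathbf e_\lambda$. *)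

(* Defs.v *)
From HB Require Import structures.
From mathcomp Require Import all_boot all_order all_algebra.
From mathcomp Require Import all_classical all_reals all_analysis.
Set Implicit Arguments.
Unset Strict Implicit.
Unset Printing Implicit Defensive.
Import Order.TTheory GRing.Theory Num.Theory.
Import numFieldNormedType.Exports.
Local Open Scope classical_set_scope.
Local Open Scope ring_scope.

(* A process (X_t)_{t >= 0} is encoded as a family indexed by all of R; every
   definition below only depends on the indices t >= 0. *)

Section paths.
Context {R : realType}.
Implicit Types (f : R -> R) (t x : R).

Definition cadlag f :=
  (forall t, 0 <= t -> f s @[s --> t^'+] --> f t) /\
  (forall t, 0 < t -> cvg (f s @[s --> t^'-])).

(* A cadlag path is bounded on [0, t], so for t >= 0 this real-valued [sup] is
   the genuine supremum. *)
Definition running_sup f t : R := sup [set f s | s in `[0, t]].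

(* Equal to +oo when the path never reaches [x, +oo[ at a positive time.
   For a Levy process this need not be measurable for an incomplete sigma-algebra,
   but it coincides outside a negligible set with a random variable. The integral
   of a nonnegative function of it, being the supremum of the integrals of the
   nonnegative simple functions below it, is then the integral with respect to
   the completed measure. *)
Definition hitting_time f x : \bar R :=
  ereal_inf [set s%:E | s in [set s : R | 0 < s /\ x <= f s]].

End paths.

Section processes.
Context {d} {Omega : measurableType d} {R : realType}.
Variable P : probability Omega R.
Local Open Scope ereal_scope.

Definition mutually_independent n (Y : 'I_n -> Omega -> R) :=
  forall A : 'I_n -> set R, (forall i, measurable (A i)) ->
    P (\bigcap_i (Y i @^-1` A i)) = \prod_(i < n) P (Y i @^-1` A i).

Record levy_process (X : R -> {RV P >-> R}) : Prop := LevyProcess {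
  levy_start0 : forall w, X 0%R w = 0%R ;
  levy_cadlag : forall w, cadlag (X ^~ w) ;
  levy_independent_increments : forall n (t : nat -> R),
    (0 <= t 0%N)%R -> {homo t : i j / (i <= j)%N >-> (i <= j)%R} ->
    mutually_independent (fun i : 'I_n => X (t i.+1) \- X (t i))%R ;
  levy_stationary_increments : forall s h : R, (0 <= s)%R -> (0 <= h)%R ->
    forall A, measurable A ->
    P ((X (s + h)%R \- X s)%R @^-1` A) = P (X h @^-1` A) }.

Definition sigma_process (X : R -> {RV P >-> R}) : set (set Omega) :=
  <<s \bigcup_(t in `[0%R, +oo[) preimage_set_system setT (X t) measurable >>.

Definition sigma_rv (e : {RV P >-> R}) : set (set Omega) :=
  preimage_set_system setT e measurable.

Definition independent_of_process (e : {RV P >-> R}) (X : R -> {RV P >-> R}) :=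
  forall A B, sigma_rv e A -> sigma_process X B -> P (A `&` B) = P A * P B.

(* The two measures are compared on Borel sets only: their values elsewhere
   carry no meaning. *)
Definition exponential_rv (e : {RV P >-> R}) (lambda : R) :=
  forall A, measurable A -> distribution P e A = exponential_prob lambda A.

End processes.

Arguments levy_process {d Omega R} P X.
Arguments exponential_rv {d Omega R} P e lambda.
Arguments independent_of_process {d Omega R} P e X.

(* Main.v *)
Require Import Defs.
From HB Require Import structures.
From mathcomp Require Import all_boot all_order all_algebra.
From mathcomp Require Import all_classical all_reals all_analysis.
From mathcomp Require Import measurable_realfun lebesgue_integral_fubini.
From mathcomp Require Import ring lra.
Import Order.TTheory GRing.Theory Num.Theory.
Import numFieldNormedType.Exports.
Local Open Scope classical_set_scope.
Local Open Scope ring_scope.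
Set Implicit Arguments.
Unset Strict Implicit.
Unset Printing Implicit Defensive.

(** Let q = exp(-lambda 2^-n), let p be the random walk X_(i 2^-n), and let N be
    the index of the first dyadic point of level n strictly after e, so that N - 1 is
    geometric of parameter q and independent of p. Splitting the path at the first
    passage time tau of p above a level y >= 0, the Markov property turns the
    maximum into p_tau plus an independent maximum over the remaining time, and
    summing against the geometric law (a Cauchy product) gives
      q E[exp(-mu M_N); M_N > y]
        = E[q^tau exp(-mu p_tau)] ((1 - q) + q E[exp(-mu M_N)]).
    As n goes to infinity M_N converges to S_e on every path, by right-continuity, and
    tau 2^-n decreases to D_y = inf {t | X_t > y}; strictness of the inequality is
    what makes the dyadic first passage times converge to D_y.
    Then let y increase strictly to x. The times D_y increase to a time D <= T, and the
    only obstruction to D = T and X_(D_y) -> X_T is a jump of X at D. It is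
    negligible: for h(z) = 1 - exp(-|z|), the Markov property at the dyadic
    approximations of D_y bounds E[exp(-lambda D_y) h(X_(D_y + s) - X_(D_y))] by
    E[h(X_s)], which tends to 0 with s, while a jump at D would keep the left-hand
    side away from 0. *)

(** * Random walks *)

(** The pi-system that generates the product sigma-algebra of R^N. The bound [m] leaves finitely
    many coordinates constrained, so that the independence of finitely many increments determines
    the probability of such a set. *)
Definition cylinder (R : realType) : set (set (nat -> R)) :=
  [set E | exists (A : nat -> set R) (m : nat),
     [/\ forall i, measurable (A i), forall i, (m <= i)%N -> A i = setT &
         E = [set v | forall i, A i (v i)]]].

Arguments cylinder R : clear implicits.

Notation seq_space R := (g_sigma_algebraType (cylinder R)).

Lemma setI_closed_cylinder (R : realType) : setI_closed (cylinder R).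
Proof.
move=> _ _ [A [m [mA Am ->]]] [B [n [mB Bn ->]]].
exists (fun i => A i `&` B i), (maxn m n); split.
- by move=> i; exact: measurableI.
- move=> i; rewrite geq_max => /andP[mi ni].
  by rewrite Am// Bn// setIT.
- apply/seteqP; split=> [v [Av Bv] i|v ABv]; first by split.
  by split=> i; have [] := ABv i.
Qed.

Lemma cylinderT (R : realType) : cylinder R setT.
Proof.
by exists (fun=> setT), 0%N; split => //; apply/seteqP; split => // v _ i.
Qed.

Lemma measurable_coord (R : realType) (i : nat) :
  measurable_fun (setT : set (seq_space R)) (fun v : seq_space R => v i).
Proof.
move=> _ B mB; rewrite setTI; apply: sub_sigma_algebra.
exists (fun k => if k == i then B else setT), i.+1; split.
- by move=> k; case: ifP.
- by move=> k ik; rewrite gtn_eqF.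
- apply/seteqP; split=> [v Bv k|v /(_ i)]; last by rewrite eqxx.
  by case: eqP => // ->.
Qed.

Lemma measurable_to_seq d (T : measurableType d) (R : realType)
    (f : T -> nat -> R) :
  (forall i, measurable_fun setT (f ^~ i)) ->
  measurable_fun setT (f : T -> seq_space R).
Proof.
move=> mf; apply: (@measurability _ _ T (seq_space R) setT f (cylinder R)) => //.
move=> _ [_ [A [m [mA _ ->]]] <-]; rewrite setTI.
have -> : f @^-1` [set v | forall i, A i (v i)] =
    \bigcap_i ((f ^~ i) @^-1` A i).
  by apply/seteqP; split=> [w Aw i _|w Aw i]; exact: Aw.
apply: bigcap_measurableType => i _; rewrite -[X in measurable X]setTI.
exact: mf.
Qed.

(** Cylinders are stable under intersection, and the whole space is itself a cylinder of finite
    measure, so the exhausting sequence can be taken constant. *)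
Lemma seq_measure_unique (R : realType) (m1 m2 : measure (seq_space R) R) :
  (m1 setT < +oo)%E -> (forall E, cylinder R E -> m1 E = m2 E) ->
  forall E : set (seq_space R), measurable E -> m1 E = m2 E.
Proof.
move=> m1oo m12 E mE.
apply: (@measure_unique _ R (seq_space R) (cylinder R) (fun=> setT)) => //.
- exact: setI_closed_cylinder.
- by move=> _; exact: cylinderT.
- by rewrite bigcup_const.
Qed.

Lemma pushforward_measure d d' (T : measurableType d) (T' : measurableType d')
    (R : realType) (mu : measure T R) (f : T -> T') :
  measurable_fun setT f ->
  exists m : measure T' R, forall E, m E = mu (f @^-1` E).
Proof.
move=> mf; unshelve epose (m := (pushforward mu f : measure T' R)).
  exact: mf.
by exists m.
Qed.

Lemma scaled_measure d (T : measurableType d) (R : realType)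
    (P : probability T R) (A : set T) : measurable A ->
  exists m : measure T R, forall E, m E = (P A * P E)%E.
Proof.
move=> mA; exists (mscale (NngNum (fine_ge0 (measure_ge0 P A))) P) => E.
by rewrite /= /mscale/= fineK// fin_num_measure.
Qed.

(** * The Markov property of a random walk at a fixed index *)

Section walk.
Context {d} {Omega : measurableType d} {R : realType} (P : probability Omega R).
Variable xi : nat -> Omega -> R.
Hypothesis mxi : forall i, measurable_fun setT (xi i).
Hypothesis indep_xi : forall n (A : nat -> set R), (forall i, measurable (A i)) ->
  P [set w | forall i, (i < n)%N -> A i (xi i w)] =
  (\prod_(i < n) P (xi i @^-1` A i))%E.
Hypothesis stat_xi : forall i A, measurable A ->
  P (xi i @^-1` A) = P (xi 0%N @^-1` A).

(** A pi-system generating the sigma-algebra of the first [j] increments. *)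
Definition past j : set (set Omega) :=
  [set E | exists A : nat -> set R, (forall i, measurable (A i)) /\
     E = [set w | forall i, (i < j)%N -> A i (xi i w)]].

Lemma past_measurable j : past j `<=` measurable.
Proof.
move=> _ [A [mA ->]].
have -> : [set w | forall i, (i < j)%N -> A i (xi i w)] =
    \bigcap_(i in `I_j) (xi i @^-1` A i) by [].
apply: bigcap_measurableType => i _; rewrite -[X in measurable X]setTI.
exact: mxi.
Qed.

Lemma sigma_past_measurable j : <<s past j >> `<=` measurable.
Proof.
apply: smallest_sub; first exact: sigma_algebra_measurable.
exact: past_measurable.
Qed.

Let shift j (w : Omega) : seq_space R := fun i => xi (j + i)%N w.

Let mshift j : measurable_fun setT (shift j).
Proof. by apply: measurable_to_seq => i; exact: mxi. Qed.

Let rectE (A : nat -> set R) m : (forall i, measurable (A i)) ->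
    (forall i, (m <= i)%N -> A i = setT) ->
  P [set w | forall i, A i (xi i w)] = (\prod_(i < m) P (xi 0%N @^-1` A i))%E.
Proof.
move=> mA Am.
have -> : [set w | forall i, A i (xi i w)] =
    [set w | forall i, (i < m)%N -> A i (xi i w)].
  apply/seteqP; split=> [w Aw i _|w Aw i]; first exact: Aw.
  by have [/Aw//|mi] := ltnP i m; rewrite Am.
by rewrite indep_xi//; apply: eq_bigr => i _; rewrite stat_xi.
Qed.

Lemma past_rect j (A : set Omega) (B : set (seq_space R)) :
  past j A -> cylinder R B ->
  P (A `&` shift j @^-1` B) = (P A * P (shift 0%N @^-1` B))%E.
Proof.
move=> [a [ma ->]] [b [m [mb bm ->]]].
(* The constraints on the past and those on the future, concatenated at [j], form a single
   rectangle, whose probability is a product over the coordinates. *)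
pose c i := if (i < j)%N then a i else b (i - j)%N.
have mc i : measurable (c i) by rewrite /c; case: ifP.
have cm i : (j + m <= i)%N -> c i = setT.
  move=> jmi; rewrite /c ltnNge (leq_trans (leq_addr m j) jmi)/= bm//.
  by rewrite leq_subRL// (leq_trans (leq_addr m j) jmi).
have -> : [set w | forall i, (i < j)%N -> a i (xi i w)] `&`
    shift j @^-1` [set v | forall i, b i (v i)] =
    [set w | forall i, c i (xi i w)].
  apply/seteqP; split=> [w [aw bw] i|w cw].
  - rewrite /c; case: ltnP => [/aw//|ji].
    by have := bw (i - j)%N; rewrite /shift subnKC.
  - split=> i.
      by move=> ij; have := cw i; rewrite /c ij.
    by have := cw (j + i)%N; rewrite /c ltnNge leq_addr/= addKn.
rewrite (@rectE _ (j + m)%N)// big_split_ord/=; congr (_ * _)%E.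
  rewrite indep_xi//; apply: eq_bigr => i _.
  by rewrite /c ltn_ord stat_xi.
rewrite (_ : _ @^-1` _ = [set w | forall i, b i (xi i w)])// (@rectE _ m)//.
by apply: eq_bigr => i _; rewrite /c/= ltnNge leq_addr/= addKn.
Qed.

(* Two monotone class arguments: first in B for a rectangle A, then in A. *)
Lemma walk_markov j (A : set Omega) (B : set (seq_space R)) :
  <<s past j >> A -> measurable B ->
  P (A `&` shift j @^-1` B) = (P A * P (shift 0%N @^-1` B))%E.
Proof.
move=> sA mB.
have mpre k (C : set (seq_space R)) : measurable C ->
    measurable (shift k @^-1` C).
  by move=> mC; rewrite -[X in measurable X]setTI; exact: mshift.
have rect_markov A' : past j A' ->
    P (A' `&` shift j @^-1` B) = (P A' * P (shift 0%N @^-1` B))%E.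
  move=> pA'; have mA' := @past_measurable j _ pA'.
  have [m1 m1E] := @pushforward_measure _ _ _ (seq_space R) _
    (mrestr P mA') _ (mshift j).
  have [m m_E] := scaled_measure P mA'.
  have [m2 m2E] := @pushforward_measure _ _ _ (seq_space R) _ m _ (mshift 0%N).
  have m12 : forall E : set (seq_space R), measurable E -> m1 E = m2 E.
    apply: seq_measure_unique.
      rewrite m1E preimage_setT /= /mrestr/= setTI.
      by rewrite ltey_eq fin_num_measure.
    by move=> E cE; rewrite m1E m2E m_E /= /mrestr setIC past_rect.
  by have := m12 _ mB; rewrite m1E m2E m_E /= /mrestr setIC.
have [m mE] := scaled_measure P (mpre 0%N _ mB).
have := @g_sigma_algebra_measure_unique _ R Omega (past j)
  (@past_measurable j) (fun=> setT) _ _ (mrestr P (mpre j _ mB)) m _ _ _ A sA.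
rewrite /= /mrestr mE [RHS in (_ -> _ = RHS)%type]muleC; apply.
- move=> _; exists (fun=> setT); split => //.
  by apply/seteqP; split=> // w _ i.
- by rewrite bigcup_const.
- move=> _ _ [a [ma ->]] [b [mb ->]]; exists (fun i => a i `&` b i); split.
    by move=> i; exact: measurableI.
  apply/seteqP; split=> [w [aw bw] i ij|w abw]; first by split; auto.
  by split=> i /abw[].
- by move=> E pE; rewrite rect_markov// mE muleC.
- by move=> _; rewrite setTI ltey_eq fin_num_measure//; exact: mpre.
Qed.

End walk.

(** The law of the pair is the product of the marginal laws, and Tonelli's theorem factors the
    integral. The targets are arbitrary measurable types so that [f] or [g] may be the identity onto
    [T] equipped with a smaller sigma-algebra. *)
Lemma integralM_indep d (T : measurableType d) (R : realType)
    (P : probability T R) d1 (T1 : measurableType d1) d2 (T2 : measurableType d2)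
    (f : T -> T1) (g : T -> T2) (u : T1 -> R) (v : T2 -> R) :
  measurable_fun setT f -> measurable_fun setT g ->
  measurable_fun setT u -> measurable_fun setT v ->
  (forall x, 0 <= u x) -> (forall x, 0 <= v x) ->
  (forall A B, measurable A -> measurable B ->
    P (f @^-1` A `&` g @^-1` B) = P (f @^-1` A) * P (g @^-1` B))%E ->
  (\int[P]_w (u (f w) * v (g w))%:E =
   \int[P]_w (u (f w))%:E * \int[P]_w (v (g w))%:E)%E.
Proof.
move=> mf mg mu mv u0 v0 fg.
pose f' : {mfun T >-> T1} := HB.pack f (isMeasurableFun.Build _ _ _ _ f mf).
pose g' : {mfun T >-> T2} := HB.pack g (isMeasurableFun.Build _ _ _ _ g mg).
have mfg : measurable_fun setT (fun w => (f w, g w)).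
  exact: measurable_fun_pair.
have [m mE] := pushforward_measure P mfg.
pose mul (z : T1 * T2) : \bar R := (u z.1 * v z.2)%:E.
have mmul : measurable_fun [set: T1 * T2] mul.
  apply/measurable_EFinP; apply: measurable_funM.
  - by apply: measurableT_comp => //; exact: measurable_fst.
  - by apply: measurableT_comp => //; exact: measurable_snd.
have mu' : measurable_fun setT (EFin \o u) by exact/measurable_EFinP.
have mv' : measurable_fun setT (EFin \o v) by exact/measurable_EFinP.
have uE : (\int[distribution P f']_x (u x)%:E = \int[P]_w (u (f w))%:E)%E.
  by rewrite ge0_integral_pushforward// => x _; rewrite lee_fin.
have vE : (\int[distribution P g']_x (v x)%:E = \int[P]_w (v (g w))%:E)%E.
  by rewrite ge0_integral_pushforward// => x _; rewrite lee_fin.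
transitivity (\int[m]_z mul z)%E.
  transitivity (\int[pushforward P (fun w => (f w, g w))]_z mul z)%E.
    rewrite ge0_integral_pushforward// => z _; rewrite lee_fin.
    by rewrite mulr_ge0.
  by congr integral; apply/funext => A; rewrite mE.
rewrite -(@eq_measure_integral _ _ _ _ _
  (distribution P f' \x distribution P g')%E); last first.
  move=> A mA _; apply: product_measure_unique => // B C mB mC.
  rewrite mE; exact: fg.
rewrite fubini_tonelli1//=; last by move=> z; rewrite lee_fin mulr_ge0.
rewrite /fubini_F/= -uE -vE.
under eq_integral.
  move=> x _; under eq_integral do rewrite /mul/= EFinM.
  rewrite ge0_integralZl//; last 2 first.
  - by move=> y _; rewrite lee_fin.
  - by rewrite lee_fin.
  over.
rewrite ge0_integralZr//.
  by move=> x _; rewrite lee_fin.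
by apply: integral_ge0 => y _; rewrite lee_fin.
Qed.

(* Bounded below by 0 whatever p is; the walks of interest have p 0 = 0. *)
Definition path_max (R : realType) (p : nat -> R) m : R :=
  \big[Num.max/0]_(i < m.+1) p i.

Definition first_passage (R : realType) (p : nat -> R) (y : R) j :=
  (y < p j) && [forall i : 'I_j, p i <= y].

(** * Maxima and first passages of a sequence *)

Section path_max.
Context {R : realType}.
Implicit Types (p : nat -> R) (y z : R).

Lemma path_max_ge0 p m : 0 <= path_max p m.
Proof. exact: bigmax_ge_id. Qed.

Lemma le_path_max p m i : (i <= m)%N -> p i <= path_max p m.
Proof.
move=> im; rewrite /path_max.
by rewrite (bigD1 (Ordinal (im : (i < m.+1)%N)))//= le_max lexx.
Qed.

Lemma path_max_le p m z : 0 <= z -> (forall i, (i <= m)%N -> p i <= z) ->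
  path_max p m <= z.
Proof.
move=> z0 pz; rewrite /path_max; elim/big_ind: _ => // [x y xz yz|i _].
  by rewrite ge_max xz.
by apply: pz; rewrite -ltnS.
Qed.

Lemma first_passageP p y j :
  reflect (y < p j /\ forall i, (i < j)%N -> p i <= y) (first_passage p y j).
Proof.
apply: (iffP andP) => -[yj yi]; split => //.
- by move=> i ij; exact: (forallP yi (Ordinal ij)).
- by apply/forallP => i; exact: yi.
Qed.

Lemma first_passage_inj p y i j :
  first_passage p y i -> first_passage p y j -> i = j.
Proof.
move=> /first_passageP[yi pi] /first_passageP[yj pj].
have [ij|ji|//] := ltngtP i j.
- by have := pj _ ij; rewrite leNgt yi.
- by have := pi _ ji; rewrite leNgt yj.
Qed.

Lemma first_passage_ex p y i : y < p i ->
  exists2 j, (j <= i)%N & first_passage p y j.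
Proof.
move=> yi; have [j yj jmin] := ex_minnP (ex_intro (fun k => y < p k) i yi).
exists j; first exact: jmin.
apply/first_passageP; split => // k kj; rewrite leNgt; apply/negP => /jmin.
by rewrite leqNgt kj.
Qed.

(** Before [j] the path stays at or below y < p_j, so the maximum is reached from [j] on. Since y >=
    0, p_j is nonnegative and the floor 0 built into [path_max] does no harm on either side. *)
Lemma path_max_first_passage p y j k : 0 <= y -> (j <= k)%N ->
  first_passage p y j ->
  path_max p k = p j + path_max (fun i => p (j + i)%N - p j) (k - j).
Proof.
move=> y0 jk /first_passageP[yj pj].
have pj0 : 0 <= p j by rewrite (le_trans y0)// ltW.
apply/eqP; rewrite eq_le; apply/andP; split.
  apply: path_max_le => [|i ik]; first by rewrite addr_ge0// path_max_ge0.
  have [ij|ji] := ltnP i j.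
    rewrite (le_trans (pj _ ij))// (le_trans (ltW yj))//.
    by rewrite lerDl path_max_ge0.
  rewrite -lerBlDl -{1}(subnKC ji).
  by apply: (le_path_max (fun i => p (j + i)%N - p j)); rewrite leq_sub2r.
rewrite -lerBrDl; apply: path_max_le => [|i ikj].
  by rewrite subr_ge0 le_path_max.
by rewrite lerD2r le_path_max// -leq_subRL.
Qed.

(** The first passage is unique, so exactly one term survives when the maximum exceeds [y], and none
    otherwise. *)
Lemma path_max_decomposition p y (mu : R) k : 0 <= y ->
  (y < path_max p k)%R%:R * expR (- mu * path_max p k) =
  \sum_(j < k.+1) (first_passage p y j)%:R * expR (- mu * p j) *
    expR (- mu * path_max (fun i => p (j + i)%N - p j) (k - j)).
Proof.
move=> y0; have [ymax|maxy] := ltP y (path_max p k).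
  have [i ik yi] : exists2 i, (i <= k)%N & y < p i.
    apply: contrapT => nyi; move: ymax; rewrite ltNge => /negP; apply.
    apply: path_max_le => // i ik; rewrite leNgt; apply/negP => yi.
    by apply: nyi; exists i.
  have [j ji fj] := first_passage_ex yi.
  have jk := leq_trans ji ik.
  rewrite (bigD1 (Ordinal (jk : (j < k.+1)%N)))//= fj !mul1r big1 ?addr0.
    by rewrite -expRD -mulrDr -(path_max_first_passage y0 jk fj).
  move=> l lj; case: (boolP (first_passage p y l)) => fl.
    by move: lj; rewrite -val_eqE/= (first_passage_inj fl fj) eqxx.
  by rewrite !mul0r.
rewrite mul0r big1// => j _; case: (boolP (first_passage p y j)) => fj.
  have /first_passageP[yj _] := fj.
  move: yj; rewrite ltNge (le_trans _ maxy)// le_path_max//.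
  by rewrite -ltnS.
by rewrite !mul0r.
Qed.

End path_max.

Lemma nneseries_cauchy_product (R : realType) (f g : nat -> R) :
  (forall i, 0 <= f i) -> (forall i, 0 <= g i) ->
  ((\sum_(m <oo) (g m)%:E)%E \is a fin_num) ->
  (\sum_(k <oo) (\sum_(j < k.+1) f j * g (k - j)%N)%:E =
   (\sum_(j <oo) (f j)%:E) * \sum_(m <oo) (g m)%:E)%E.
Proof.
move=> f0 g0 gfin.
(* Extended by 0 for k < j, so that both summations range over all integers and can be exchanged. *)
pose t j k : \bar R := if (j <= k)%N then (f j * g (k - j)%N)%:E else 0%E.
have t0 j k : (0 <= t j k)%E.
  by rewrite /t; case: ifP => // _; rewrite lee_fin mulr_ge0.
transitivity (\sum_(k <oo) \sum_(j <oo) t j k)%E.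
  apply: eq_eseriesr => k _.
  rewrite (nneseries_split 0 k.+1)// [X in (_ + X)%E]eseries0 ?adde0.
    rewrite add0n big_mkord -sumEFin; apply: eq_bigr => j _.
    by rewrite /t -ltnS ltn_ord.
  by move=> j; rewrite add0n => kj _; rewrite /t leqNgt kj.
rewrite nneseries_interchange//.
transitivity (\sum_(j <oo) ((f j)%:E * \sum_(m <oo) (g m)%:E))%E; last first.
  rewrite -(fineK gfin); under eq_eseriesr do rewrite muleC.
  rewrite nneseriesZl; first by rewrite muleC.
  by move=> j _; rewrite lee_fin.
apply: eq_eseriesr => j _.
rewrite (nneseries_split 0 j)// big1_seq ?add0e; last first.
  move=> k /=; rewrite mem_index_iota add0n => /andP[_ kj].
  by rewrite /t leqNgt kj.
rewrite add0n -nneseries_addn// -nneseriesZl.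
  by apply: eq_eseriesr => m _; rewrite /t leq_addl addnK EFinM.
by move=> m _; rewrite lee_fin.
Qed.

Lemma measurable_nat_of_bool d (T : measurableType d) (R : realType)
    (b : T -> bool) : measurable_fun setT b ->
  measurable_fun setT (fun w => (b w)%:R : R).
Proof.
move=> mb; have -> : (fun w => (b w)%:R : R) = \1_(b @^-1` [set true]).
  apply/funext => w; rewrite indicE; congr (_%:R).
  by case E : (b w); [rewrite mem_set|rewrite memNset//= E].
by apply: measurable_indic; rewrite -[X in measurable X]setTI; exact: mb.
Qed.

Section measurable_path.
Context {d} {T : measurableType d} {R : realType}.
Implicit Types p : T -> nat -> R.

Lemma measurable_path_max p m :
  (forall i, (i <= m)%N -> measurable_fun setT (p ^~ i)) ->
  measurable_fun setT (fun w => path_max (p w) m).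
Proof.
elim: m p => [|m IH] p mp.
  have -> : (fun w => path_max (p w) 0) = (fun w => Num.max (p w 0%N) 0).
    by apply/funext => w; rewrite /path_max big_ord_recl big_ord0.
  by apply: measurable_maxr => //; exact: mp.
have -> : (fun w => path_max (p w) m.+1) =
    (fun w => Num.max (p w 0%N) (path_max (fun i => p w i.+1) m)).
  by apply/funext => w; rewrite /path_max big_ord_recl.
apply: measurable_maxr; first exact: mp.
by apply: IH => i im; exact: mp.
Qed.

Lemma measurable_first_passage p y j :
  (forall i, (i <= j)%N -> measurable_fun setT (p ^~ i)) ->
  measurable_fun setT (fun w => (first_passage (p w) y j)%:R : R).
Proof.
move=> mp; apply: measurable_nat_of_bool; apply: measurable_and.
  by apply: measurable_fun_ltr => //; exact: mp.
have : forall i, (i < j)%N -> measurable_fun setT (p ^~ i).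
  by move=> i ij; apply: mp; exact: ltnW.
elim: j {mp} => [|j IH] mp.
  have -> : (fun w => [forall i : 'I_0, p w i <= y]) = cst true.
    by apply/funext => w; apply/forallP => -[].
  exact: measurable_cst.
have -> : (fun w => [forall i : 'I_j.+1, p w i <= y]) =
    (fun w => [forall i : 'I_j, p w i <= y] && (p w j <= y)).
  apply/funext => w; apply/forallP/andP => [pw|[/forallP pw pj] i].
    split; last exact: pw ord_max.
    by apply/forallP => i; exact: pw (widen_ord (leqnSn j) i).
  have [ij|] := ltnP i j; first exact: pw (Ordinal ij).
  by move=> ji; have -> : nat_of_ord i = j
    by apply/eqP; rewrite eqn_leq ji -ltnS ltn_ord.
apply: measurable_and.
  by apply: IH => i ij; apply: mp; exact: ltnW.
by apply: measurable_fun_ler => //; exact: mp.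
Qed.

End measurable_path.

(** * Expectations of functions with values in [0, 1] *)

Section mean.
Context {d} {T : measurableType d} {R : realType} (P : probability T R).
Implicit Types f g : T -> R.

(** On a probability space this one condition gives integrability, finite means, and dominated
    convergence with the constant bound 1. *)
Definition unit_valued f :=
  measurable_fun setT f /\ forall w, 0 <= f w <= 1.

(* Only meaningful for integrable f, since [fine] sends infinities to 0. *)
Definition mean f : R := fine ('E_P[f])%E.

Lemma unit_valued_integrable f : unit_valued f ->
  P.-integrable setT (EFin \o f).
Proof.
move=> [mf f01]; apply: (@le_integrable _ _ _ _ _ _ _ (cst 1%E)) => //.
- exact/measurable_EFinP.
- move=> w _ /=; have /andP[f0 f1] := f01 w.
  by rewrite lee_fin ger0_norm// ger0_norm.
- exact: finite_measure_integrable_cst.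
Qed.

Lemma meanE f : unit_valued f -> ('E_P[f] = (mean f)%:E)%E.
Proof.
move=> uf; rewrite /mean fineK// unlock.
by apply: integrable_fin_num => //; exact: unit_valued_integrable.
Qed.

Lemma mean_ge0 f : unit_valued f -> 0 <= mean f.
Proof.
move=> uf; rewrite -lee_fin -meanE//; apply: expectation_ge0 => w.
by have /andP[] := uf.2 w.
Qed.

Lemma le_mean f g : unit_valued f -> unit_valued g ->
  (forall w, f w <= g w) -> mean f <= mean g.
Proof.
move=> uf ug fg; rewrite -lee_fin -!meanE//; apply: expectation_le.
- exact: uf.1.
- exact: ug.1.
- by move=> w; have /andP[] := uf.2 w.
- by move=> w; have /andP[] := ug.2 w.
- by apply/aeW => w; exact: fg.
Qed.

Lemma mean_cst (r : R) : mean (cst r) = r.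
Proof. by rewrite /mean expectation_cst. Qed.

Lemma mean_le1 f : unit_valued f -> mean f <= 1.
Proof.
move=> uf; rewrite -[leRHS](mean_cst 1); apply: le_mean => //.
- by split => // w; rewrite lexx ler01.
- by move=> w; have /andP[] := uf.2 w.
Qed.

Lemma unit_valuedM f g : unit_valued f -> unit_valued g ->
  unit_valued (fun w => f w * g w).
Proof.
move=> [mf f01] [mg g01]; split; first exact: measurable_funM.
move=> w; have /andP[f0 f1] := f01 w; have /andP[g0 g1] := g01 w.
by rewrite mulr_ge0//= mulr_ile1.
Qed.

Lemma cvg_mean (f_ : nat -> T -> R) f : (forall n, unit_valued (f_ n)) ->
  (forall w, f_ n w @[n --> \oo] --> f w) ->
  unit_valued f /\ mean (f_ n) @[n --> \oo] --> mean f.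
Proof.
move=> uf_ f_f.
have uf : unit_valued f.
  split; first by apply: measurable_fun_cvg => // n; exact: (uf_ n).1.
  move=> w; have cf := cvgP _ (f_f w); rewrite -(cvg_lim _ (f_f w))//.
  apply/andP; split.
    by apply: limr_ge => //; near=> n; have /andP[] := (uf_ n).2 w.
  by apply: limr_le => //; near=> n; have /andP[] := (uf_ n).2 w.
split => //; apply: fine_cvg; rewrite -meanE// unlock.
apply: (@dominated_cvg _ _ _ _ _ _ _ _ (cst 1%E)) => //.
- by move=> n; apply/measurable_EFinP; exact: (uf_ n).1.
- by move=> w _; apply: cvg_EFin; [near=> n|exact: f_f].
- exact: finite_measure_integrable_cst.
- move=> n w _; have /andP[f0 f1] := (uf_ n).2 w.
  by rewrite lee_fin ger0_norm.
Unshelve. all: by end_near. Qed.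

End mean.

Lemma nneseries_cvgP (R : realType) (f : nat -> R) (l : R) :
  (forall i, 0 <= f i) ->
  (\sum_(j < n) f j @[n --> \oo] --> l) <-> (\sum_(j <oo) (f j)%:E = l%:E)%E.
Proof.
move=> f0.
have partE n : (\sum_(0 <= j < n) (f j)%:E = (\sum_(j < n) f j)%:E)%E.
  by rewrite sumEFin big_mkord.
split=> [fl|fl].
  apply/cvg_lim => //; under eq_fun do rewrite partE.
  by apply: cvg_EFin fl; near=> n.
apply: (@fine_cvg _ _ _ _ (fun n => (\sum_(j < n) f j)%:E)).
rewrite -fl; under eq_fun do rewrite -partE.
by apply: is_cvg_nneseries => n _ _; rewrite lee_fin.
Unshelve. all: by end_near. Qed.

Lemma cvg_cauchy_product (R : realType) (f g : nat -> R) (a b : R) :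
  (forall i, 0 <= f i) -> (forall i, 0 <= g i) ->
  \sum_(j < n) f j @[n --> \oo] --> a ->
  \sum_(j < n) g j @[n --> \oo] --> b ->
  \sum_(k < n) (\sum_(j < k.+1) f j * g (k - j)%N) @[n --> \oo] --> a * b.
Proof.
move=> f0 g0 /(nneseries_cvgP _ f0) fa /(nneseries_cvgP _ g0) gb.
have fg0 k : 0 <= \sum_(j < k.+1) f j * g (k - j)%N.
  by apply: sumr_ge0 => j _; rewrite mulr_ge0.
apply/(nneseries_cvgP _ fg0).
by rewrite nneseries_cauchy_product// gb ?fa ?EFinM.
Qed.

Lemma cvg_partial_sum_const (R : realType) (f : nat -> R) k :
  (forall j, j != k -> f j = 0) -> \sum_(j < n) f j @[n --> \oo] --> f k.
Proof.
move=> fk; apply: cvg_near_cst; near=> n.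
have kn : (k < n)%N by near: n; exact: nbhs_infty_gt.
rewrite (bigD1 (Ordinal kn))//= big1 ?addr0// => j jk; apply: fk.
by rewrite -val_eqE in jk.
Unshelve. all: by end_near. Qed.

(* The value of g at the first passage of p above y, and 0 if there is none: at
   most one term of the sum is nonzero. *)
Definition first_value (R : realType) (p : nat -> R) y (g : nat -> R) : R :=
  limn (fun n => \sum_(j < n) (first_passage p y j)%:R * g j).

Section first_value.
Context {R : realType}.
Implicit Types (p g : nat -> R).

Let cvg_first_passage p y g j : first_passage p y j ->
  \sum_(i < n) (first_passage p y i)%:R * g i @[n --> \oo] --> g j.
Proof.
move=> fj; have -> : g j = (first_passage p y j)%:R * g j by rewrite fj mul1r.
apply: (@cvg_partial_sum_const _ (fun i => (first_passage p y i)%:R * g i)).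
move=> i ij; case: (boolP (first_passage p y i)) => fi; last by rewrite mul0r.
by move: ij; rewrite (first_passage_inj fi fj) eqxx.
Qed.

Let cvg_no_passage p y g : (forall j, ~~ first_passage p y j) ->
  \sum_(i < n) (first_passage p y i)%:R * g i @[n --> \oo] --> (0 : R).
Proof.
move=> nf; apply: cvg_near_cst; near=> n; rewrite big1// => i _.
by rewrite (negbTE (nf i)) mul0r.
Unshelve. all: by end_near. Qed.

Lemma first_valueE p y g j : first_passage p y j -> first_value p y g = g j.
Proof. by move=> fj; apply/cvg_lim => //; exact: cvg_first_passage. Qed.

Lemma first_value0 p y g : (forall j, p j <= y) -> first_value p y g = 0.
Proof.
move=> py; apply/cvg_lim => //; apply: cvg_no_passage => j.
by apply/negP => /first_passageP[]; rewrite ltNge py.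
Qed.

Lemma cvg_first_value p y g :
  \sum_(i < n) (first_passage p y i)%:R * g i @[n --> \oo] -->
  first_value p y g.
Proof.
have [[j fj]|nf] := pselect (exists j, first_passage p y j).
  by rewrite (first_valueE _ fj); exact: cvg_first_passage.
have cvg0 : \sum_(i < n) (first_passage p y i)%:R * g i @[n --> \oo] --> (0 : R).
  by apply: cvg_no_passage => j; apply/negP => fj; apply: nf; exists j.
by rewrite /first_value (cvg_lim _ cvg0).
Qed.

Lemma first_passage_sum_le1 p y g n :
  (forall j, first_passage p y j -> 0 <= g j <= 1) ->
  0 <= \sum_(j < n) (first_passage p y j)%:R * g j <= 1.
Proof.
move=> g01; have [[j fj]|nf] := pselect (exists2 j, (j < n)%N & first_passage p y j).
  move=> fpj; rewrite (bigD1 (Ordinal fj))//= fpj mul1r big1 ?addr0; first exact: g01.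
  move=> i ij; case: (boolP (first_passage p y i)) => fi; last by rewrite mul0r.
  by move: ij; rewrite -val_eqE/= (first_passage_inj fi fpj) eqxx.
rewrite big1 ?lexx ?ler01// => i _.
case: (boolP (first_passage p y i)) => fi; last by rewrite mul0r.
by exfalso; apply: nf; exists i.
Qed.

End first_value.

Section mean_series.
Context {d} {T : measurableType d} {R : realType} (P : probability T R).

Lemma mean_sum n (f : nat -> T -> R) : (forall j, unit_valued (f j)) ->
  mean P (fun w => \sum_(j < n) f j w) = \sum_(j < n) mean P (f j).
Proof.
move=> uf; apply: EFin_inj; rewrite -sumEFin.
under [RHS]eq_bigr do rewrite -meanE//.
rewrite /mean fineK unlock; last first.
  apply: integrable_fin_num => //.
  have -> : (fun w => (\sum_(j < n) f j w)%:E) =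
      (fun w => (\sum_(j < n) (f j w)%:E)%E).
    by apply/funext => w; rewrite sumEFin.
  by apply: integrable_sum => // j _; exact: unit_valued_integrable.
under eq_integral do rewrite -sumEFin.
rewrite ge0_integral_sum//.
- by move=> j; apply/measurable_EFinP; exact: (uf j).1.
- by move=> j w _; rewrite lee_fin; have /andP[] := (uf j).2 w.
Qed.

Lemma meanD (f g : T -> R) : unit_valued f -> unit_valued g ->
  mean P (fun w => f w + g w) = mean P f + mean P g.
Proof.
move=> uf ug; have := @mean_sum 2 (fun j => if j == 0%N then f else g).
rewrite !big_ord_recl big_ord0/= addr0 => <-; last by case.
by congr (mean P _); apply/funext => w; rewrite !big_ord_recl big_ord0/= addr0.
Qed.

Lemma meanZl (r : R) (f : T -> R) : 0 <= r -> unit_valued f ->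
  mean P (fun w => r * f w) = r * mean P f.
Proof.
move=> r0 uf; rewrite /mean unlock; under eq_integral do rewrite EFinM.
rewrite ge0_integralZl//.
- rewrite fineM//; first by apply: integrable_fin_num => //; exact: unit_valued_integrable.
- by apply/measurable_EFinP; exact: uf.1.
- by move=> w _; rewrite lee_fin; have /andP[] := uf.2 w.
Qed.

Lemma cvg_mean_series (f : nat -> T -> R) (g : T -> R) :
  (forall j, unit_valued (f j)) ->
  (forall n w, \sum_(j < n) f j w <= 1) ->
  (forall w, \sum_(j < n) f j w @[n --> \oo] --> g w) ->
  unit_valued g /\ \sum_(j < n) mean P (f j) @[n --> \oo] --> mean P g.
Proof.
move=> uf sf fg.
have us n : unit_valued (fun w => \sum_(j < n) f j w).
  split; first by apply: measurable_sum => j; exact: (uf j).1.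
  move=> w; rewrite sf andbT; apply: sumr_ge0 => j _.
  by have /andP[] := (uf j).2 w.
have [ug mg] := cvg_mean P us fg; split => //.
by under eq_fun do rewrite -mean_sum//.
Qed.

End mean_series.

(** * First passage and maximum of a random walk at a geometric time *)

Section random_walk.
Context {d} {Omega : measurableType d} {R : realType} (P : probability Omega R).
Variable p : Omega -> nat -> R.
Hypothesis p0 : forall w, p w 0%N = 0.
Hypothesis mp : forall i, measurable_fun setT (p ^~ i).
Let xi i w := p w i.+1 - p w i.
Hypothesis indep_xi : forall n (A : nat -> set R), (forall i, measurable (A i)) ->
  P [set w | forall i, (i < n)%N -> A i (xi i w)] =
  (\prod_(i < n) P (xi i @^-1` A i))%E.
Hypothesis stat_xi : forall i A, measurable A ->
  P (xi i @^-1` A) = P (xi 0%N @^-1` A).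

Let mxi i : measurable_fun setT (xi i).
Proof. exact: measurable_funB. Qed.

(** Rebuilds a walk from its increments: a function of the recentred path after [j] thereby becomes
    a function of the shifted increments, to which the Markov property applies. *)
Let position (v : seq_space R) : seq_space R := fun i => \sum_(l < i) v l.

Let mposition : measurable_fun setT position.
Proof.
apply: measurable_to_seq => i; apply: measurable_sum => l.
exact: measurable_coord.
Qed.

Let positionE j w :
  position (fun i => xi (j + i)%N w) = (fun i => p w (j + i)%N - p w j).
Proof.
apply/funext; elim => [|i IH]; first by rewrite /position big_ord0 addn0 subrr.
rewrite /position big_ord_recr/= [X in X + _]IH /xi addnS.
by rewrite addrC addrA subrK.
Qed.

Lemma past_measurable_path i j : (i <= j)%N ->
  measurable_fun (setT : set (g_sigma_algebraType (past xi j))) (p ^~ i).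
Proof.
move=> ij; have -> : p ^~ i = fun w => \sum_(l < i) xi l w.
  apply/funext => w; have /(congr1 (fun u => u i)) := positionE 0 w.
  by rewrite add0n p0 subr0 => <-.
have mxil l : (l < j)%N ->
    measurable_fun (setT : set (g_sigma_algebraType (past xi j))) (xi l).
  move=> lj _ B mB; rewrite setTI; apply: sub_sigma_algebra.
  exists (fun k => if k == l then B else setT); split.
    by move=> k; case: ifP.
  apply/seteqP; split=> [w Bw k _|w /(_ l lj)]; last by rewrite eqxx.
  by case: eqP => // ->.
apply: measurable_sum => l; apply: mxil.
by rewrite (leq_trans _ ij).
Qed.

(** The functional form of [walk_markov]. Taking the whole space as the past event shows that the
    shifted increments have the law of the unshifted ones, which removes [j] from the second
    factor. *)
Lemma mean_past_shift j (U : Omega -> R) (v : seq_space R -> R) :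
  measurable_fun (setT : set (g_sigma_algebraType (past xi j))) U ->
  (forall w, 0 <= U w <= 1) ->
  measurable_fun setT v -> (forall x, 0 <= v x <= 1) ->
  mean P (fun w => U w * v (fun i => p w (j + i)%N - p w j)) =
  mean P U * mean P (fun w => v (p w)).
Proof.
move=> mU U01 mv v01.
pose sh k w : seq_space R := fun i => xi (k + i)%N w.
have msh k : measurable_fun setT (sh k).
  by apply: measurable_to_seq => i; exact: mxi.
have midO : measurable_fun setT (id : Omega -> g_sigma_algebraType (past xi j)).
  move=> _ A mA; rewrite setTI; exact: sigma_past_measurable mA.
have mUO : measurable_fun setT U by exact: measurableT_comp mU midO.
have markov A (B : set (seq_space R)) : <<s past xi j >> A -> measurable B ->
    P (A `&` sh j @^-1` B) = (P A * P (sh 0%N @^-1` B))%E.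
  exact: walk_markov.
have law B : measurable B -> P (sh j @^-1` B) = P (sh 0%N @^-1` B).
  move=> mB; have := @markov setT B (@measurableT _ (g_sigma_algebraType (past xi j))) mB.
  by rewrite setTI probability_setT mul1e.
pose V := v \o position.
have mV : measurable_fun setT V by exact: measurableT_comp.
have V0 x : (0 <= V x) by have /andP[] := v01 (position x).
have U0 w : 0 <= U w by have /andP[] := U01 w.
have vE k w : v (fun i => p w (k + i)%N - p w k) = V (sh k w).
  by rewrite /V /= -positionE.
have -> : (fun w => v (p w)) = V \o sh 0%N.
  apply/funext => w; rewrite /= -vE; congr v; apply/funext => i.
  by rewrite add0n p0 subr0.
have lawV : (\int[P]_w (V (sh j w))%:E = \int[P]_w (V (sh 0%N w))%:E)%E.
  have [m1 m1E] := pushforward_measure P (msh j).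
  have [m2 m2E] := pushforward_measure P (msh 0%N).
  have intE k (m : measure (seq_space R) R) : (forall E, m E = P (sh k @^-1` E)) ->
      (\int[P]_w (V (sh k w))%:E = \int[m]_x (V x)%:E)%E.
    move=> mE; transitivity (\int[pushforward P (sh k)]_x (V x)%:E)%E.
      rewrite ge0_integral_pushforward//; last by move=> x _; rewrite lee_fin.
      exact/measurable_EFinP.
    by congr integral; apply/funext => E; rewrite mE.
  rewrite (intE _ m1)// (intE _ m2)//; apply: eq_measure_integral => B mB _.
  by rewrite m1E m2E; exact: law.
apply: EFin_inj.
have uU : unit_valued U by [].
have uV k : unit_valued (V \o sh k).
  split; first exact: measurableT_comp.
  by move=> w; exact: v01.
have -> : (fun w => U w * v (fun i => p w (j + i)%N - p w j)) =
    (fun w => U w * (V \o sh j) w) by apply/funext => w; rewrite vE.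
rewrite EFinM -!meanE//; last exact: unit_valuedM.
rewrite unlock -lawV.
apply: (@integralM_indep _ Omega _ P _ (g_sigma_algebraType (past xi j)) _
  (seq_space R) id (sh j) U V) => //.
by move=> A B mA mB; rewrite law//; exact: markov.
Qed.


Lemma unit_valued_first_passage y j (g : Omega -> R) :
  measurable_fun setT g ->
  (forall w, first_passage (p w) y j -> 0 <= g w <= 1) ->
  unit_valued (fun w => (first_passage (p w) y j)%:R * g w).
Proof.
move=> mg g01; split.
  by apply: measurable_funM => //; exact: measurable_first_passage.
move=> w; case: (boolP (first_passage (p w) y j)) => [/g01|_].
  by rewrite mul1r.
by rewrite mul0r lexx ler01.
Qed.

Lemma cvg_mean_first_value y (g : Omega -> nat -> R) :
  (forall j, measurable_fun setT (g ^~ j)) ->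
  (forall w j, first_passage (p w) y j -> 0 <= g w j <= 1) ->
  unit_valued (fun w => first_value (p w) y (g w)) /\
  \sum_(j < n) mean P (fun w => (first_passage (p w) y j)%:R * g w j)
    @[n --> \oo] --> mean P (fun w => first_value (p w) y (g w)).
Proof.
move=> mg g01; apply: (@cvg_mean_series _ _ _ P
  (fun j w => (first_passage (p w) y j)%:R * g w j)).
- by move=> j; apply: unit_valued_first_passage => // w; exact: g01.
- move=> n w; have /andP[] // := first_passage_sum_le1 n (g01 w).
- by move=> w; exact: cvg_first_value.
Qed.

Let expR_unit (mu z : R) : 0 <= mu -> 0 <= z -> 0 <= expR (- mu * z) <= 1.
Proof.
by move=> mu0 z0; rewrite expR_ge0/= -expR0 ler_expR mulNr oppr_le0 mulr_ge0.
Qed.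

Lemma first_passage_expR_unit y (mu : R) w j : 0 <= y -> 0 <= mu ->
  first_passage (p w) y j -> 0 <= expR (- mu * p w j) <= 1.
Proof.
move=> y0 mu0 /first_passageP[yj _]; apply: expR_unit => //.
by rewrite (le_trans y0)// ltW.
Qed.

Let measurable_expRM (mu : R) d' (T : measurableType d') (f : T -> R) :
  measurable_fun setT f -> measurable_fun setT (fun w => expR (- mu * f w)).
Proof.
by move=> mf; apply: measurableT_comp => //; exact: measurable_funM.
Qed.

Lemma unit_valued_path_max (mu : R) k : 0 <= mu ->
  unit_valued (fun w => expR (- mu * path_max (p w) k)).
Proof.
move=> mu0; split; last by move=> w; apply: expR_unit => //; exact: path_max_ge0.
by apply: measurable_expRM; exact: measurable_path_max.
Qed.

Let measurable_past_first_passage y j : measurable_fun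
  (setT : set (g_sigma_algebraType (past xi j)))
  (fun w => (first_passage (p w) y j)%:R : R).
Proof.
apply: (@measurable_first_passage _ (g_sigma_algebraType (past xi j))) => i ij.
exact: past_measurable_path.
Qed.

(** The pathwise decomposition is averaged term by term: the first passage at [j] and the value p_j
    depend on the first [j] increments, the remaining maximum on the path recentred at [j]. *)
Lemma mean_path_max_decomposition (y mu : R) k : 0 <= y -> 0 <= mu ->
  mean P (fun w => (y < path_max (p w) k)%R%:R *
                   expR (- mu * path_max (p w) k)) =
  \sum_(j < k.+1)
    mean P (fun w => (first_passage (p w) y j)%:R * expR (- mu * p w j)) *
    mean P (fun w => expR (- mu * path_max (p w) (k - j))).
Proof.
move=> y0 mu0; under eq_fun do rewrite path_max_decomposition//.
pose v m (x : seq_space R) := expR (- mu * path_max x m).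
have mv m : measurable_fun setT (v m).
  apply: measurable_expRM; apply: measurable_path_max => i _.
  exact: measurable_coord.
have v01 m x : 0 <= v m x <= 1 by apply: expR_unit => //; exact: path_max_ge0.
pose U j w := (first_passage (p w) y j)%:R * expR (- mu * p w j).
have uU j : unit_valued (U j).
  apply: unit_valued_first_passage; first exact: measurable_expRM.
  by move=> w; exact: first_passage_expR_unit.
rewrite (@mean_sum _ _ _ P _ (fun j w => U j w *
  v (k - j)%N (fun i => p w (j + i)%N - p w j))); last first.
  move=> j; apply: unit_valuedM => //; split => //.
  apply: measurable_expRM; apply: measurable_path_max => i _.
  exact: measurable_funB.
apply: eq_bigr => j _; apply: mean_past_shift => //; last exact: (uU j).2.
apply: measurable_funM => //; apply: measurable_expRM.
exact: past_measurable_path.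
Qed.

(** Writing q^k = q^j q^(k-j) turns the geometric average of the decomposition into the Cauchy
    product of the discounted first passage series with the series of [gamma]. *)
Lemma cvg_mean_path_max (y mu q gamma : R) : 0 <= y -> 0 <= mu -> 0 < q < 1 ->
  \sum_(m < n) (1 - q) * q ^+ m * mean P (fun w => expR (- mu * path_max (p w) m))
    @[n --> \oo] --> gamma ->
  \sum_(k < n) (1 - q) * q ^+ k *
      mean P (fun w => (y < path_max (p w) k)%R%:R *
                       expR (- mu * path_max (p w) k))
    @[n --> \oo] -->
  mean P (fun w => first_value (p w) y (fun j => q ^+ j * expR (- mu * p w j))) *
  gamma.
Proof.
move=> y0 mu0 /andP[q0 q1] cg.
have q01 j : 0 <= q ^+ j <= 1 by rewrite exprn_ge0 ?(ltW q0)// exprn_ile1 ?(ltW q0) ?(ltW q1).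
pose U j w := (first_passage (p w) y j)%:R * expR (- mu * p w j).
have uU j : unit_valued (U j).
  apply: unit_valued_first_passage; first exact: measurable_expRM.
  by move=> w; exact: first_passage_expR_unit.
have [] := @cvg_mean_first_value y (fun w j => q ^+ j * expR (- mu * p w j)).
- by move=> j; apply: measurable_funM => //; exact: measurable_expRM.
- move=> w j /first_passage_expR_unit -/(_ _ y0 mu0)/andP[e0 e1].
  have /andP[qj0 qj1] := q01 j.
  by rewrite mulr_ge0//= mulr_ile1.
move=> _ ca.
have meanU j : mean P (fun w => (first_passage (p w) y j)%:R *
    (q ^+ j * expR (- mu * p w j))) = q ^+ j * mean P (U j).
  rewrite -meanZl//; last by have /andP[] := q01 j.
  by congr mean; apply/funext => w; rewrite /U mulrCA.
have fg := @cvg_cauchy_product R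
  (fun j => mean P (fun w => (first_passage (p w) y j)%:R *
    (q ^+ j * expR (- mu * p w j))))
  (fun m => (1 - q) * q ^+ m * mean P (fun w => expR (- mu * path_max (p w) m)))
  _ _ _ _ ca cg.
have -> : (fun n => \sum_(k < n) (1 - q) * q ^+ k *
      mean P (fun w => (y < path_max (p w) k)%R%:R *
                       expR (- mu * path_max (p w) k))) =
  (fun n => \sum_(k < n) \sum_(j < k.+1)
     mean P (fun w => (first_passage (p w) y j)%:R *
       (q ^+ j * expR (- mu * p w j))) *
     ((1 - q) * q ^+ (k - j) *
        mean P (fun w => expR (- mu * path_max (p w) (k - j))))).
  apply/funext => n; apply: eq_bigr => k _.
  rewrite mean_path_max_decomposition// mulr_sumr; apply: eq_bigr => j _.
  have -> : q ^+ k = q ^+ j * q ^+ (k - j) by rewrite -exprD subnKC// -ltnS.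
  by rewrite meanU /U; ring.
apply: fg => i.
- rewrite meanU mulr_ge0 ?mean_ge0//; by have /andP[] := q01 i.
- rewrite !mulr_ge0 ?subr_ge0 ?mean_ge0 ?(ltW q1)//; first by have /andP[] := q01 i.
  exact: unit_valued_path_max.
Qed.

(** Given a first passage at [j], the next [m] steps have the law of the first [m]. The discount q^j
    is at most 1, and the disjoint events of first passage at [j] have total probability at most
    1. *)
Lemma mean_increment_after_first_passage y (q : R) m (h : R -> R) :
  0 <= q <= 1 -> measurable_fun setT h -> (forall z, 0 <= h z <= 1) ->
  unit_valued (fun w => first_value (p w) y
    (fun j => q ^+ j * h (p w (j + m)%N - p w j))) /\
  mean P (fun w => first_value (p w) y
    (fun j => q ^+ j * h (p w (j + m)%N - p w j))) <= mean P (fun w => h (p w m)).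
Proof.
move=> /andP[q0 q1] mh h01.
have q01 j : 0 <= q ^+ j <= 1 by rewrite exprn_ge0// exprn_ile1.
have mhp j : measurable_fun setT (fun w => h (p w (j + m)%N - p w j)).
  by apply: measurableT_comp => //; exact: measurable_funB.
have [] := @cvg_mean_first_value y (fun w j => q ^+ j * h (p w (j + m)%N - p w j)).
- by move=> j; exact: measurable_funM.
- move=> w j _; have /andP[qj0 qj1] := q01 j.
  have /andP[h0 h1] := h01 (p w (j + m)%N - p w j).
  by rewrite mulr_ge0//= mulr_ile1.
move=> uv cv; split => //.
rewrite -(cvg_lim _ cv)//; apply: limr_le; first exact: cvgP cv.
near=> n.
have ufp j : unit_valued (fun w => (first_passage (p w) y j)%:R : R).
  have := @unit_valued_first_passage y j (cst 1).
  under eq_fun do rewrite mulr1; apply => //.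
  by move=> w _; rewrite ler01 lexx.
have uh : unit_valued (fun w => h (p w m)).
  by split => //; exact: measurableT_comp.
have hv : measurable_fun setT (fun x : seq_space R => h (x m)).
  by apply: measurableT_comp => //; exact: measurable_coord.
have termE j : mean P (fun w => (first_passage (p w) y j)%:R *
    (q ^+ j * h (p w (j + m)%N - p w j))) =
    q ^+ j * (mean P (fun w => (first_passage (p w) y j)%:R) *
              mean P (fun w => h (p w m))).
  rewrite -(@mean_past_shift j (fun w => (first_passage (p w) y j)%:R)
    (fun x => h (x m)))//; last by exact: (ufp j).2.
  rewrite -meanZl//; first by congr mean; apply/funext => w; rewrite mulrCA.
    by have /andP[] := q01 j.
  by apply: unit_valuedM => //; split.
under eq_bigr do rewrite termE.
apply: (@le_trans _ _ (\sum_(j < n) mean P (fun w => (first_passage (p w) y j)%:R)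
    * mean P (fun w => h (p w m)))).
  apply: ler_sum => j _; have /andP[qj0 qj1] := q01 j.
  by rewrite ler_piMl// mulr_ge0// mean_ge0.
rewrite -mulr_suml ler_piMl ?mean_ge0//.
rewrite -(@mean_sum _ _ _ P n (fun j w => (first_passage (p w) y j)%:R))//.
apply: mean_le1.
split; first by apply: measurable_sum => j; exact: (ufp j).1.
move=> w; have := @first_passage_sum_le1 _ (p w) y (cst 1) n.
under eq_bigr do rewrite mulr1; apply.
by move=> j _; rewrite ler01 lexx.
Unshelve. all: by end_near. Qed.

End random_walk.

(** * Cadlag paths on dyadic grids *)

Lemma cvg_at_right_dist (R : realType) (f : R -> R) (t l e : R) :
  f s @[s --> t^'+] --> l -> 0 < e ->
  exists2 r, 0 < r & forall s, t < s -> s < t + r -> `|f s - l| < e.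
Proof.
move=> /cvgrPdist_lt fl e0; have [r /= r0 tr] := fl e e0.
exists r => // s ts st; rewrite distrC; apply: tr => //=.
by rewrite ltr_distlC; apply/andP; split; lra.
Qed.

Lemma cvg_at_left_dist (R : realType) (f : R -> R) (t l e : R) :
  f s @[s --> t^'-] --> l -> 0 < e ->
  exists2 r, 0 < r & forall s, t - r < s -> s < t -> `|f s - l| < e.
Proof.
move=> /cvgrPdist_lt fl e0; have [r /= r0 tr] := fl e e0.
exists r => // s ts st; rewrite distrC; apply: tr => //=.
by rewrite ltr_distlC; apply/andP; split; lra.
Qed.

Section cadlag_paths.
Context {R : realType}.
Implicit Types (f g : R -> R) (t x y : R).

Lemma cvg_at_right_continuous_dist f t (e : R) :
  f s @[s --> t^'+] --> f t -> 0 < e ->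
  exists2 r, 0 < r & forall s, t <= s -> s < t + r -> `|f s - f t| < e.
Proof.
move=> ft e0; have [r r0 fr] := cvg_at_right_dist ft e0.
exists r => // s; rewrite le_eqVlt => /predU1P[->|]; last exact: fr.
by rewrite subrr normr0.
Qed.

Lemma cadlag_right_dist f t (e : R) : cadlag f -> 0 <= t -> 0 < e ->
  exists2 r, 0 < r & forall s, t <= s -> s < t + r -> `|f s - f t| < e.
Proof. by move=> [rf _] t0; apply: cvg_at_right_continuous_dist; exact: rf. Qed.

(* Compactness of [0, t]: the one-sided limits bound f near each point. *)
Lemma cadlag_has_ubound f t : cadlag f -> has_ubound [set f s | s in `[0, t]].
Proof.
move=> cf; have := @segment_compact R 0 t.
move=> /compact_near_coveringP/(_ R (pinfty_nbhs R)
  (fun M s => 0 <= s -> f s <= M) _) [].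
  move=> s; rewrite /= in_itv/= => /andP[s0 _].
  have [r r0 fr] := cadlag_right_dist cf s0 ltr01.
  have [M [r' r'0 fM]] : exists M, exists2 r', 0 < r' &
      forall u, s - r' < u -> u < s -> 0 <= u -> f u <= M.
    (* At s = 0 no point of [0, +oo[ lies to the left, and any bound will do. *)
    move: s0; rewrite le_eqVlt => /predU1P[<-|s0].
      by exists 0, 1 => // u _; rewrite ltNge => /negbTE->.
    have /cvg_ex[l fl] := cf.2 s s0.
    have [r' r'0 fr'] := cvg_at_left_dist fl ltr01.
    exists (l + 1), r' => // u su us _; have := fr' u su us.
    by rewrite ltr_distl => /andP[_ /ltW].
  exists (ball s (Num.min r r'), [set N | Num.max (f s + 1) M <= N]).
    split => /=; first by apply: nbhsx_ballx; rewrite lt_min r0.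
    by exists (Num.max (f s + 1) M); split; [exact: num_real|move=> N /ltW].
  move=> [u N]/= []; rewrite /ball/= ltr_distlC => /andP[su us].
  rewrite ge_max => /andP[fsN MN] u0.
  have [us'|su'] := ltP u s.
    rewrite (le_trans _ MN)//; apply: fM => //.
    by rewrite (le_lt_trans _ su)// lerD2l lerN2 ge_min lexx orbT.
  rewrite (le_trans _ fsN)//; have := fr u su'.
  rewrite ltr_distl => /(_ _)/andP[]; last by move=> _ /ltW.
  by rewrite (lt_le_trans us)// lerD2l ge_min lexx.
move=> M [_ fM]; exists (M + 1) => _ [s st <-].
apply: fM => //; first by rewrite ltrDl.
by move: st; rewrite /= in_itv/= => /andP[].
Qed.

Definition mesh n : R := 2^-1 ^+ n.

Definition grid f n i : R := f (i%:R * mesh n).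

Lemma mesh_gt0 n : 0 < mesh n.
Proof. by rewrite exprn_gt0// invr_gt0. Qed.

Lemma cvg_mesh : mesh n @[n --> \oo] --> 0.
Proof.
by apply: cvg_expr; rewrite ger0_norm ?invr_ge0// invf_lt1// ltr1n.
Qed.

(* The grid point [grid_index n t * mesh n] is strictly to the right of t >= 0, so
   right-continuity applies to it; for t < 0 it is the point [mesh n]. *)
Definition grid_index n t := (Num.truncn (t / mesh n)).+1.

Lemma grid_index_gt n t : t < (grid_index n t)%:R * mesh n.
Proof. by rewrite -ltr_pdivrMr ?mesh_gt0// truncnS_gt. Qed.

Lemma grid_index_le n t : 0 <= t -> (grid_index n t)%:R * mesh n <= t + mesh n.
Proof.
move=> t0; rewrite /grid_index -natr1 mulrDl mul1r lerD2r.
rewrite -ler_pdivlMr ?mesh_gt0// truncn_le.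
by rewrite divr_ge0// ltW// mesh_gt0.
Qed.

Lemma le_grid_index n s t : s <= t -> (grid_index n s <= grid_index n t)%N.
Proof.
move=> st; rewrite ltnS le_truncn// ler_pM2r// invr_gt0; exact: mesh_gt0.
Qed.

Lemma lt_grid_index n t i : 0 <= t -> (i < grid_index n t)%N -> i%:R * mesh n <= t.
Proof.
move=> t0; rewrite ltnS truncn_ge_nat; last by rewrite divr_ge0// ltW// mesh_gt0.
by rewrite ler_pdivlMr ?mesh_gt0.
Qed.

Lemma cvg_grid_index t : 0 <= t ->
  (grid_index n t)%:R * mesh n @[n --> \oo] --> t.
Proof.
move=> t0; apply: (@squeeze_cvgr _ _ _ _ (cst t) (fun n => t + mesh n)).
- by near=> n; rewrite ltW ?grid_index_gt//= grid_index_le.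
- exact: cvg_cst.
- by rewrite -[X in _ --> X]addr0; apply: cvgD; [exact: cvg_cst|exact: cvg_mesh].
Unshelve. all: by end_near. Qed.

Lemma cvg_cadlag_grid f t : cadlag f -> 0 <= t ->
  grid f n (grid_index n t) @[n --> \oo] --> f t.
Proof.
move=> [rf _] t0; have /cvg_at_rightP := rf t t0; apply; split.
  by move=> n; exact: grid_index_gt.
exact: cvg_grid_index.
Qed.

(** From below, a point nearly achieving the supremum is approached from the right by grid points
    whose index is at most that of [t]. From above, every grid point used lies in [0, t] except the
    last, which tends to [t] from the right. *)
Lemma cvg_path_max_grid f t : cadlag f -> f 0 = 0 ->
  path_max (grid f n) (grid_index n t) @[n --> \oo] --> running_sup f t.
Proof.
move=> cf f0.
(* For t < 0 the interval is empty, and [sup] takes its default value 0, which is also the value at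
   t = 0; the grid index is 1 in both cases. An exponential variable may be negative on a null
   event, and convergence is wanted on every path. *)
wlog t0 : t / 0 <= t.
  move=> H; have [/H//|t0] := leP 0 t.
  have -> : running_sup f t = running_sup f 0.
    rewrite /running_sup set_itv_ge ?image_set0 ?sup0; last by rewrite -leNgt/= bnd_simp ?ltW.
    by rewrite set_itv1 image_set1 f0 sup1.
  have -> : (fun n => path_max (grid f n) (grid_index n t)) =
      (fun n => path_max (grid f n) (grid_index n 0)).
    apply/funext => n; congr path_max; rewrite /grid_index mul0r truncn0.
    congr S; apply/truncn0Pn; rewrite -ltNge.
    by rewrite (@lt_trans _ _ 0)// pmulr_llt0// invr_gt0 mesh_gt0.
  exact: H.
have ubf := cadlag_has_ubound t cf.
have le_sup s : 0 <= s -> s <= t -> f s <= running_sup f t.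
  by move=> s0 st; apply: ub_le_sup => //; exists s => //=; rewrite in_itv/= s0.
have sup0 : 0 <= running_sup f t by rewrite -f0 le_sup.
have hs : has_sup [set f s | s in `[0, t]].
  by split => //; exists (f 0), 0 => //=; rewrite in_itv/= lexx.
apply/cvgrPdist_le => e e0.
have [_ [s /= + <-] fs] := sup_adherent (divr_gt0 e0 (ltr0n _ 2)) hs.
rewrite in_itv/= => /andP[s0 st].
have e20 : 0 < e / 2 by rewrite divr_gt0.
near=> n; rewrite ler_distlC; apply/andP; split.
  rewrite lerBlDr; apply: (@le_trans _ _ (grid f n (grid_index n s) + e)).
    have : `|f s - grid f n (grid_index n s)| < e / 2.
      near: n; have /cvgrPdist_lt := cvg_cadlag_grid cf s0; exact.
    move: fs; rewrite -/(running_sup f t) ltr_distlC => fs /andP[h1 h2].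
    by lra.
  by rewrite lerD2r le_path_max// le_grid_index.
apply: path_max_le => [|i]; first by rewrite addr_ge0// ltW.
(* The last grid point, strictly to the right of [t], is handled by right-continuity. *)
rewrite leq_eqVlt => /predU1P[->|/(lt_grid_index t0) it].
  have : `|f t - grid f n (grid_index n t)| < e.
    near: n; have /cvgrPdist_lt := cvg_cadlag_grid cf t0; exact.
  rewrite ltr_distlC => /andP[_ /ltW/le_trans]; apply.
  by rewrite lerD2r le_sup.
have i0 : 0 <= i%:R * mesh n by rewrite mulr_ge0// ltW// mesh_gt0.
by rewrite (le_trans (le_sup _ i0 it))// lerDl ltW.
Unshelve. all: by end_near. Qed.

End cadlag_paths.

(** * Exceedance times and their dyadic approximation *)

Section exceedance.
Context {R : realType}.
Implicit Types (f g : R -> R) (t x y : R).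

Definition exceed_time f y : \bar R :=
  ereal_inf [set s%:E | s in [set s : R | 0 <= s /\ y < f s]].

(** The continuous-time counterpart of [first_value], with the same default 0 when the level is
    never exceeded. *)
Definition at_exceed f y g : R :=
  if exceed_time f y is t%:E then g t else 0.

Lemma ereal_inf_EFin_min (A : set R) t : A t -> (forall s, A s -> t <= s) ->
  ereal_inf [set s%:E | s in A] = t%:E.
Proof.
move=> At tA; apply/eqP; rewrite eq_le; apply/andP; split.
  by apply: ereal_inf_lbound; exists t.
by apply: le_ereal_inf_tmp => _ [s As <-]; rewrite lee_fin tA.
Qed.

Lemma exceed_timeP f y :
  (exceed_time f y = +oo%E /\ forall s, 0 <= s -> f s <= y) \/
  exists t, [/\ exceed_time f y = t%:E, 0 <= t,
    forall s, 0 <= s -> y < f s -> t <= s &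
    forall e, 0 < e -> exists s, [/\ 0 <= s, y < f s & s < t + e]].
Proof.
have [[s [s0 ys]]|nys] := pselect (exists s, 0 <= s /\ y < f s); last first.
  left; split; last first.
    by move=> s s0; rewrite leNgt; apply/negP => ys; apply: nys; exists s.
  rewrite /exceed_time (_ : [set s | _] = set0) ?image_set0 ?ereal_inf0//.
  by apply/seteqP; split => // s [s0 ys]; apply: nys; exists s.
right; set A := [set s | 0 <= s /\ y < f s].
have lA : lbound A 0 by move=> u [].
have hA : has_inf A by split; [exists s|exists 0].
exists (inf A); split.
- by rewrite /exceed_time ereal_inf_EFin//; exact: hA.1 || exact: hA.2.
- by apply: lb_le_inf => //; exact: hA.1.
- by move=> u u0 yu; apply: ge_inf; [exact: hA.2|split].
- move=> e e0; have [u [u0 yu] ul] := inf_adherent e0 hA.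
  by exists u.
Qed.

(** A strict inequality y < f s passes by right-continuity to the grid points approaching [s] from
    the right. Choosing [s] just after the exceedance time t traps the first grid passage in [t, t +
    r[ on fine grids, where g is close to g t. *)
Lemma cvg_first_value_grid f y g : cadlag f ->
  (forall t, 0 <= t -> g s @[s --> t^'+] --> g t) ->
  first_value (grid f n) y (grid g n) @[n --> \oo] --> at_exceed f y g.
Proof.
move=> cf rg; rewrite /at_exceed.
have [[-> fy]|[t [-> t0 lt_exceed exceed_lt]]] := exceed_timeP f y.
  rewrite (_ : (fun n => _) = cst 0); first exact: cvg_cst.
  apply/funext => n; apply: first_value0 => j; apply: fy.
  by rewrite mulr_ge0// ltW// mesh_gt0.
apply/cvgrPdist_lt => e e0.
have [r r0 gr] := cvg_at_right_continuous_dist (rg t t0) e0.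
have [s [s0 ys str]] := exceed_lt r r0.
near=> n.
have fsn : y < grid f n (grid_index n s).
  near: n; have := cvg_cadlag_grid cf s0; move/cvgr_gt; exact.
have snr : (grid_index n s)%:R * mesh n < t + r.
  near: n; have := cvg_grid_index s0; move/cvgr_lt; exact.
have [j ji fj] := first_passage_ex fsn.
rewrite (first_valueE _ fj) distrC; have /first_passageP[yj _] := fj.
apply: gr; first by apply: lt_exceed => //; rewrite mulr_ge0// ltW// mesh_gt0.
by rewrite (le_lt_trans _ snr)// ler_pM2r ?mesh_gt0// ler_nat.
Unshelve. all: by end_near. Qed.

(** For x > 0 these levels increase strictly to [x] from the value 0, hence are all nonnegative, as
    the walk identity demands. *)
Definition level x n : R := x * (1 - mesh n).

Lemma mesh_decr m n : (m <= n)%N -> mesh n <= mesh m :> R.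
Proof.
move=> mn; apply: ler_wiXn2l; rewrite ?invr_ge0//.
by rewrite invf_le1// ler1n.
Qed.

Lemma mesh_le1 n : mesh n <= 1 :> R.
Proof. exact: (mesh_decr (leq0n n)). Qed.

Lemma level_ge0 x n : 0 < x -> 0 <= level x n.
Proof. by move=> x0; rewrite mulr_ge0 ?(ltW x0)// subr_ge0 mesh_le1. Qed.

Lemma level_lt x n : 0 < x -> level x n < x.
Proof.
by move=> x0; rewrite gtr_pMr// ltrBlDr ltrDl mesh_gt0.
Qed.

Lemma le_level x m n : 0 < x -> (m <= n)%N -> level x m <= level x n.
Proof. by move=> x0 mn; rewrite ler_pM2l// lerD2l lerN2 mesh_decr. Qed.

Lemma cvg_level x : level x n @[n --> \oo] --> x.
Proof.
have {2}-> : x = x * (1 - 0) by rewrite subr0 mulr1.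
apply: cvgM; first exact: cvg_cst.
by apply: cvgB; [exact: cvg_cst|exact: cvg_mesh].
Qed.

(** A continuous measure of distance to 0, with values in [0, 1] so that it is [unit_valued] along
    any random variable. *)
Definition jump_size (z : R) := 1 - expR (- `|z|).

Lemma jump_size_bounds z : 0 <= jump_size z <= 1.
Proof.
rewrite /jump_size subr_ge0 -[X in _ <= X]expR0 ler_expR oppr_le0 normr_ge0/=.
by rewrite lerBlDr lerDl expR_ge0.
Qed.

Lemma jump_size_gt0 z : 0 < z -> 0 < jump_size z.
Proof.
by move=> z0; rewrite /jump_size subr_gt0 -[X in _ < X]expR0 ltr_expR oppr_lt0 gtr0_norm.
Qed.

Lemma le_jump_size z z' : `|z| <= `|z'| -> jump_size z <= jump_size z'.
Proof. by move=> zz'; rewrite lerD2l lerN2 ler_expR lerN2. Qed.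

Lemma continuous_jump_size : continuous jump_size.
Proof.
move=> z; apply: cvgB; first exact: cvg_cst.
apply: continuous_comp; last exact: continuous_expR.
by apply: cvgN; exact: norm_continuous.
Qed.

(** Otherwise right-continuity would keep [f] below [y] on an interval after [t], against the choice
    of [t] as an infimum. *)
Lemma exceed_value f y t : cadlag f -> exceed_time f y = t%:E -> y <= f t.
Proof.
move=> cf ft; have [[fy _]|[u [fu u0 lt_exceed exceed_lt]]] := exceed_timeP f y.
  by rewrite fy in ft.
have <- : u = t by move: ft; rewrite fu => -[].
rewrite leNgt; apply/negP => fty.
have fty' : 0 < y - f u by rewrite subr_gt0.
have [r r0 fr] := cadlag_right_dist cf u0 fty'.
have [s [s0 ys sr]] := exceed_lt r r0.
have := fr s (lt_exceed s s0 ys) sr.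
by rewrite ltr_distl => /andP[_]; rewrite addrC subrK ltNge (ltW ys).
Qed.

End exceedance.

(** * From exceedance times of lower levels to the hitting time, on one path *)

Section left_continuity_at_hitting.
Context {R : realType}.
Variables (f : R -> R) (x lambda mu : R).
Hypotheses (cf : cadlag f) (f0 : f 0 = 0) (x0 : 0 < x) (lambda0 : 0 < lambda)
  (mu0 : 0 <= mu).

Definition discounted (h : R -> R) t := expR (- lambda * t) * h t.

Definition increment_size j t := jump_size (f (t + mesh j) - f t).

(* What a jump of f at the limit of the exceedance times of [level x k] would
   cause; only lower limits are involved, so that Fatou's lemma rules it out. *)
Definition jumps_at_level := exists2 c : R, 0 < c &
  exists j0, forall j, (j0 <= j)%N -> exists k0, forall k, (k0 <= k)%N ->
    c <= at_exceed f (level x k) (discounted (increment_size j)).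

Let g t := expR (- lambda * t - mu * f t).

Lemma cvg_at_exceed_level : ~ jumps_at_level ->
  at_exceed f (level x k) g @[k --> \oo] -->
  (if hitting_time f x is t%:E then g t else 0).
Proof.
move=> nojump.
have hitting_infty : (forall t, 0 < t -> f t < x) -> hitting_time f x = +oo%E.
  move=> ftx; rewrite /hitting_time (_ : [set s | _] = set0) ?image_set0 ?ereal_inf0//.
  by apply/seteqP; split => // s [s0]; rewrite leNgt ftx.
(* First case: the path stays at or below some level smaller than [x]; both sides are 0. *)
have [[k0 fk0]|] := pselect (exists k, forall s, 0 <= s -> f s <= level x k).
  rewrite hitting_infty; last first.
    by move=> t t0; rewrite (le_lt_trans (fk0 _ (ltW t0)))// level_lt.
  apply: cvg_near_cst; near=> k; rewrite /at_exceed.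
  have [[-> //]|[t [_ _ _ /(_ 1 ltr01)[s [s0 ks _]]]]] := exceed_timeP f (level x k).
  exfalso; move: ks; rewrite ltNge (le_trans (fk0 s s0))// le_level//.
  by near: k; exact: nbhs_infty_ge.
move=> exceeds.
have /choice[D DP] : forall k, exists t, [/\ exceed_time f (level x k) = t%:E, 0 <= t,
    forall s, 0 <= s -> level x k < f s -> t <= s &
    forall e, 0 < e -> exists s, [/\ 0 <= s, level x k < f s & s < t + e]].
  move=> k; have [[_ fk]|//] := exceed_timeP f (level x k).
  by exfalso; apply: exceeds; exists k.
have DE k : exceed_time f (level x k) = (D k)%:E by have [] := DP k.
have D0 k : 0 <= D k by have [] := DP k.
have D_le k s : 0 <= s -> level x k < f s -> D k <= s.
  by have [_ _ + _] := DP k; exact.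
have atE k h : at_exceed f (level x k) h = h (D k) by rewrite /at_exceed DE.
have fD k : level x k <= f (D k) by apply: exceed_value.
have ndD : nondecreasing_seq D.
  move=> m n mn; apply/ler_addgt0Pr => e e0.
  have [_ _ _ /(_ e e0)[s [s0 ns /ltW]]] := DP n; apply: le_trans.
  by apply: D_le => //; rewrite (le_lt_trans _ ns)// le_level.
have D_hit t : 0 < t -> x <= f t -> forall k, D k <= t.
  by move=> t0 xt k; apply: D_le; rewrite ?ltW// (lt_le_trans _ xt)// level_lt.
under eq_fun do rewrite atE.
(* Second case, treated first: the exceedance times are unbounded. Then [x] is never reached, and
   since f (D n) >= 0 the discount alone sends g (D n) to 0. *)
have [ubD|nubD] := pselect (has_ubound (range D)); last first.
  rewrite hitting_infty; last first.
    move=> t t0; rewrite ltNge; apply/negP => xt; apply: nubD.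
    by exists t => _ [k _ <-]; exact: D_hit.
  have Doo : D n @[n --> \oo] --> +oo.
    apply: nondecreasing_dvgn_lt => // /cvg_ex[l Dl]; apply: nubD.
    exists l => _ [k _ <-]; rewrite -(cvg_lim _ Dl)//.
    by apply: nondecreasing_cvgn_le => //; exact: cvgP Dl.
  apply/cvgrPdist_le => e e0; near=> n.
  rewrite sub0r normrN ger0_norm ?expR_ge0// /g.
  have Dn : - ln e / lambda <= D n by near: n; move/cvgryPge : Doo; exact.
  rewrite -[leRHS]lnK ?posrE// ler_expR.
  have : 0 <= mu * f (D n) by rewrite mulr_ge0// (le_trans (level_ge0 n x0)).
  by move: Dn; rewrite ler_pdivrMr// mulrC; lra.
(* Third case: the exceedance times increase to a finite [t]. Either they reach it, or f (D k) tends
   to the left limit at [t], which must be f t because a jump is excluded. *)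
have Dl := nondecreasing_cvgn ndD ubD.
set t := sup (range D) in Dl.
have Dt k : D k <= t by apply: ub_le_sup => //; exists k.
have cvg_fD : f (D k) @[k --> \oo] --> f t.
  have [[k0 Dk0]|Dlt] := pselect (exists k, D k = t).
    apply: cvg_near_cst; near=> k; congr f.
    apply/eqP; rewrite eq_le Dt/= -Dk0; apply: ndD.
    by near: k; exact: nbhs_infty_ge.
  have {Dlt}Dlt k : D k < t.
    by rewrite lt_neqAle Dt andbT; apply/eqP => Dk; apply: Dlt; exists k.
  have t0 : 0 < t by rewrite (le_lt_trans (D0 0%N)).
  have /cvg_ex[l fl] := cf.2 t t0.
  have fDl : f (D k) @[k --> \oo] --> l by move/cvg_at_leftP : fl; apply; split.
  have [->//|ftl] := eqVneq (f t) l.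
  exfalso; apply: nojump; pose e := `|f t - l|.
  have e0 : 0 < e by rewrite normr_gt0 subr_eq0.
  have e20 : 0 < e / 2 by rewrite divr_gt0.
  have e40 : 0 < e / 4 by rewrite divr_gt0.
  (* For [mesh j] small and D k close to [t], the window from D k to D k + mesh j straddles [t]. Its
     two end values are within e/4 of [l] and of f t, so the increment is at least e - e/4 - e/4 =
     e/2, and D k <= t bounds the discount below. *)
  exists (expR (- lambda * t) * jump_size (e / 2)).
    by rewrite mulr_gt0 ?expR_gt0// jump_size_gt0.
  have [r r0 fr] := cadlag_right_dist cf (ltW t0) e40.
  have : \forall j \near \oo, mesh j < r :> R by have := @cvg_mesh R; move/cvgr_lt; exact.
  move=> [j0 _ j0r]; exists j0 => j /j0r /= jr.
  have : \forall k \near \oo, t - mesh j < D k /\ `|l - f (D k)| < e / 4.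
    near=> k; split; near: k.
      by move/cvgr_gt : Dl; apply; rewrite ltrBlDr ltrDl mesh_gt0.
    by move/cvgrPdist_lt : fDl; exact.
  move=> [k0 _ k0P]; exists k0 => k /k0P /= [tD lD].
  rewrite atE /discounted ler_pM ?expR_ge0//.
  - by have /andP[] := jump_size_bounds (e / 2).
  - by rewrite ler_expR !mulNr lerN2 ler_pM2l.
  - apply: le_jump_size; rewrite gtr0_norm//.
    have : `|f (D k + mesh j) - f t| < e / 4.
      apply: fr; first by rewrite ltW// -ltrBlDr.
      by rewrite (lt_trans (y := t + mesh j))// ?ltrD2r ?ltrD2l.
    move=> h; have : e <= `|f (D k + mesh j) - f (D k)| +
        (`|f (D k + mesh j) - f t| + `|l - f (D k)|).
      have -> : e = `|(f (D k + mesh j) - f (D k)) -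
          ((f (D k + mesh j) - f t) + (l - f (D k)))| by congr (`|_|); ring.
      by rewrite (le_trans (ler_normB _ _))// lerD2l ler_normD.
    by lra.
have xft : x <= f t.
  rewrite -(cvg_lim _ (@cvg_level _ x))// -(cvg_lim _ cvg_fD)//.
  apply: ler_lim; [exact: cvgP (@cvg_level _ x)|exact: cvgP cvg_fD|].
  by near=> k; exact: fD.
(* [hitting_time] only looks at positive times; the start f 0 = 0 < x excludes t = 0. *)
have t0 : 0 < t.
  rewrite lt_neqAle (le_trans (D0 0%N))// andbT; apply/eqP => t0.
  by move: xft; rewrite -t0 f0 leNgt x0.
have -> : hitting_time f x = t%:E.
  apply: ereal_inf_EFin_min => // s [s0 xs]; apply: ge_sup.
    by exists (D 0%N), 0%N.
  by move=> _ [k _ <-]; exact: D_hit.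
apply: (cvg_comp _ expR); last exact: continuous_expR.
by apply: cvgB; apply: cvgM => //; exact: cvg_cst.
Unshelve. all: by end_near. Qed.

End left_continuity_at_hitting.

(** * Levy processes at an independent exponential time *)

Section exponential_time.
Context {d} {Omega : measurableType d} {R : realType} (P : probability Omega R).
Variables (lambda : R) (e : {RV P >-> R}).
Hypotheses (lambda0 : 0 < lambda) (he : exponential_rv P e lambda).

Lemma exponential_prob_itvNyo (z : R) : 0 <= z ->
  exponential_prob lambda `]-oo, z[ = (1 - expR (- lambda * z))%:E.
Proof.
move=> z0.
have mpdf D : measurable_fun D (fun t => (exponential_pdf lambda t)%:E).
  apply/measurable_EFinP; apply: measurable_funTS.
  exact: measurable_exponential_pdf.
have zE : exponential_prob lambda `]-oo, z[ = exponential_prob lambda `[0, z].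
  rewrite /exponential_prob integral_itv_bndo_bndc//.
  rewrite integral_mkcond [RHS]integral_mkcond; apply: eq_integral => t _.
  rewrite !patchE !mem_setE !in_itv/=; have [t0|t0] := leP 0 t; first by [].
  by rewrite lt0_exponential_pdf//; case: ifP.
move: z0; rewrite le_eqVlt => /predU1P[z0|z0]; last first.
  by rewrite zE exponential_prob_itv0c.
rewrite zE -z0 mulr0 expR0 subrr /exponential_prob.
by rewrite set_itv1 integral_set1.
Qed.

(** The index is never 0, and it is at most k + 1 exactly when [e] lies below (k + 1) [mesh n]: this
    is the tail of a geometric law on the positive integers. *)
Lemma mean_grid_index_le n k :
  mean P (fun w => (grid_index n (e w) <= k)%N%:R) =
  1 - expR (- lambda * mesh n) ^+ k.
Proof.
case: k => [|k].
  rewrite expr0 subrr -[RHS](mean_cst P 0); congr (mean P _).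
have -> : (fun w => (grid_index n (e w) <= k.+1)%N%:R) =
    \1_(e @^-1` `]-oo, (k.+1%:R * mesh n)[) :> (Omega -> R).
  apply/funext => w; rewrite indicE ltnS truncn_le_nat.
  rewrite ltr_pdivrMr ?mesh_gt0//; congr (_%:R).
  by congr nat_of_bool; apply/idP/idP; rewrite inE /= in_itv.
rewrite /mean expectation_indic; last first.
  by rewrite -[X in measurable X]setTI; exact: measurable_funPT.
have := he (measurable_itv `]-oo, (k.+1%:R * mesh n)[).
rewrite /distribution /pushforward => ->.
rewrite exponential_prob_itvNyo ?mulr_ge0 ?(ltW (mesh_gt0 n))//=.
congr (1 - _); rewrite -expRM_natl; congr expR; ring.
Qed.

End exponential_time.

Notation process_space X := (g_sigma_algebraType
  (\bigcup_(t in `[0%R, +oo[) preimage_set_system setT (X t) measurable)).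

(** * A Lévy process sampled on a dyadic grid, and the grid index of the exponential time *)

Section levy_walk.
Context {d} {Omega : measurableType d} {R : realType} (P : probability Omega R).
Variable X : R -> {RV P >-> R}.
Hypothesis hX : levy_process P X.

Let path n w i := grid (X ^~ w) n i.

Lemma levy_grid0 n w : path n w 0%N = 0.
Proof. by rewrite /path /grid mul0r (levy_start0 hX). Qed.

Lemma measurable_levy_grid n i : measurable_fun setT (path n ^~ i).
Proof. exact: measurable_funPT. Qed.

Lemma levy_grid_independent n m (A : nat -> set R) :
  (forall i, measurable (A i)) ->
  P [set w | forall i, (i < m)%N -> A i (path n w i.+1 - path n w i)] =
  (\prod_(i < m) P ((fun w => path n w i.+1 - path n w i)%R @^-1` A i))%E.
Proof.
move=> mA.
have := @levy_independent_increments _ _ _ _ _ hX m (fun i => i%:R * mesh n) _ _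
  (fun i : 'I_m => A i) (fun i => mA i).
rewrite mul0r => /(_ (lexx _)) <-.
  congr (P _); apply/seteqP; split=> [w Aw i _|w Aw i im]; first exact: Aw.
  exact: (Aw (Ordinal im)).
by move=> i j ij; rewrite ler_pM2r ?mesh_gt0// ler_nat.
Qed.

Lemma levy_grid_stationary n i A : measurable A ->
  P ((fun w => path n w i.+1 - path n w i) @^-1` A) =
  P ((fun w => path n w 1%N - path n w 0%N) @^-1` A).
Proof.
move=> mA; have m0 := ltW (@mesh_gt0 R n).
have -> : (fun w => path n w i.+1 - path n w i) =
    (X (i%:R * mesh n + mesh n) \- X (i%:R * mesh n))%R.
  by apply/funext => w; rewrite /path /grid -natr1 mulrDl mul1r.
rewrite (levy_stationary_increments hX) ?mulr_ge0//.
have -> // : (fun w => path n w 1%N - path n w 0%N) = X (mesh n).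
by apply/funext => w; rewrite levy_grid0 subr0 /path /grid mul1r.
Qed.

Variables (lambda : R) (e : {RV P >-> R}).
Hypotheses (lambda0 : 0 < lambda) (he : exponential_rv P e lambda)
  (heX : independent_of_process P e X).

Lemma measurable_sigma_process t : 0 <= t ->
  measurable_fun (setT : set (process_space X)) (X t).
Proof.
move=> t0 _ B mB; apply: sub_sigma_algebra; exists t; last by exists B.
by rewrite /= in_itv/= t0.
Qed.

Lemma sigma_process_measurable : sigma_process X `<=` measurable.
Proof.
apply: smallest_sub; first exact: sigma_algebra_measurable.
move=> _ [t _ [B mB <-]]; exact: measurable_funPT.
Qed.

(** The variable is split according to the value of the index, which depends on [e] alone and so is
    independent of each [Y k]. The shift to k + 1 reflects that the index starts at 1. *)
Lemma mean_exponential_time n (Y : nat -> Omega -> R) :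
  (forall k, measurable_fun (setT : set (process_space X)) (Y k)) ->
  (forall k w, 0 <= Y k w <= 1) ->
  let q := expR (- lambda * mesh n) in
  unit_valued (fun w => Y (grid_index n (e w)) w) /\
  \sum_(k < m) (1 - q) * q ^+ k * mean P (Y k.+1) @[m --> \oo] -->
  mean P (fun w => Y (grid_index n (e w)) w).
Proof.
move=> mY Y01 q.
pose I k w : R := (grid_index n (e w) == k)%:R.
pose u k (z : R) : R := (grid_index n z == k)%:R.
have mle k : measurable_fun setT (fun z : R => (grid_index n z <= k)%N).
  case: k => [|k].
    by rewrite (_ : (fun z => _) = cst false).
  have -> : (fun z : R => (grid_index n z <= k.+1)%N) =
      (fun z => z < k.+1%:R * mesh n).
    by apply/funext => z; rewrite ltnS truncn_le_nat ltr_pdivrMr ?mesh_gt0.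
  by apply: measurable_fun_ltr.
(* As a difference of two indicators of [at most] events, the indicator of one value inherits
   measurability and its mean. *)
have uE k z : u k.+1 z = (grid_index n z <= k.+1)%N%:R - (grid_index n z <= k)%N%:R.
  rewrite /u [(_ <= k.+1)%N]leq_eqVlt ltnS; case: eqP => [->|_] /=.
    by rewrite ltnn subr0.
  by rewrite subrr.
have mu k : measurable_fun setT (u k.+1).
  rewrite (_ : u k.+1 = (fun z => (grid_index n z <= k.+1)%N%:R -
    (grid_index n z <= k)%N%:R)); last first.
    by apply/funext => z; exact: uE.
  by apply: measurable_funB; exact: measurable_nat_of_bool.
have u01 k z : 0 <= u k z <= 1 by rewrite /u; case: (_ == _); rewrite ?lexx ler01.
have uI k : unit_valued (I k.+1).
  by split=> [|w]; [exact: (measurableT_comp (mu k))|exact: u01].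
have midO : measurable_fun setT (id : Omega -> process_space X).
  by move=> _ A mA; rewrite setTI; exact: sigma_process_measurable.
have uY k : unit_valued (Y k).
  by split => //; exact: measurableT_comp (mY k) midO.
have meanI k : mean P (I k.+1) = (1 - q) * q ^+ k.
  have ule j : unit_valued (fun w => (grid_index n (e w) <= j)%N%:R : R).
    split; last by move=> w; case: (_ <= _)%N; rewrite ?lexx ler01.
    apply: measurable_nat_of_bool; exact: (measurableT_comp (mle j)).
  have := meanD P (ule k) (uI k).
  rewrite (_ : (fun w => _ + _) = (fun w => (grid_index n (e w) <= k.+1)%N%:R)).
    by rewrite !(mean_grid_index_le he) -/q exprS; lra.
  by apply/funext => w; rewrite /I -/(u _ _) uE addrC subrK.
have indepI k : mean P (fun w => I k.+1 w * Y k.+1 w) =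
    (1 - q) * q ^+ k * mean P (Y k.+1).
  rewrite -meanI; apply: EFin_inj; rewrite EFinM -!meanE//; last exact: unit_valuedM.
  rewrite unlock.
  apply: (@integralM_indep _ Omega _ P _ R _
    (process_space X) e id (u k.+1) (Y k.+1)) => //.
  - by move=> w; have /andP[] := Y01 k.+1 w.
  - by move=> A B mA mB; apply: heX => //; exists A => //; rewrite setTI.
have [] := @cvg_mean_series _ _ _ P (fun k w => I k.+1 w * Y k.+1 w)
  (fun w => Y (grid_index n (e w)) w).
- by move=> k; exact: unit_valuedM.
- move=> m w; have [km|km] := ltnP (grid_index n (e w)).-1 m.
    rewrite (bigD1 (Ordinal km))//= big1 ?addr0.
      by rewrite /I eqxx mul1r; have /andP[] := Y01 (grid_index n (e w)) w.
    move=> j; rewrite -val_eqE/= => jk.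
    by rewrite /I eqSS eq_sym (negbTE jk) mul0r.
  rewrite big1 ?ler01// => j _; rewrite /I eqSS gtn_eqF ?mul0r//.
  by rewrite (leq_trans _ km).
- move=> w; set k := (grid_index n (e w)).-1.
  have -> : Y (grid_index n (e w)) w = I k.+1 w * Y k.+1 w.
    by rewrite /I eqxx mul1r.
  apply: (@cvg_partial_sum_const _ (fun k => I k.+1 w * Y k.+1 w)) => j jk.
  by rewrite /I eqSS eq_sym (negbTE jk) mul0r.
move=> uv cv; split => //.
by under eq_fun do under eq_bigr do rewrite -indepI.
Qed.

End levy_walk.

(** Passes from the law of the index, which starts at 1, to the geometric law starting at 0 of
    [cvg_mean_path_max]. The separated term k = 0 is the origin of the summand 1 - q in the grid
    identity. *)
Lemma cvg_geometric_shift (R : realType) (q s : R) (u : nat -> R) :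
  \sum_(k < n) (1 - q) * q ^+ k * u k.+1 @[n --> \oo] --> s ->
  \sum_(k < n) (1 - q) * q ^+ k * u k @[n --> \oo] --> (1 - q) * u 0%N + q * s.
Proof.
move=> us; rewrite -cvg_shiftS /=.
have -> : (fun n => \sum_(k < n.+1) (1 - q) * q ^+ k * u k) =
    (fun n => (1 - q) * u 0%N + q * \sum_(k < n) (1 - q) * q ^+ k * u k.+1).
  apply/funext => n; rewrite big_ord_recl/= expr0 mulr1 mulr_sumr; congr (_ + _).
  by apply: eq_bigr => k _; rewrite /bump/= exprS; ring.
by apply: cvgD; [exact: cvg_cst|apply: cvgM => //; exact: cvg_cst].
Qed.

Lemma path_max0 (R : realType) (p : nat -> R) : p 0%N = 0 -> path_max p 0 = 0.
Proof. by move=> p0; rewrite /path_max big_ord_recl big_ord0 p0 maxxx. Qed.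

(** * The identity at a fixed level: on a grid, then in the limit *)

Section levy_identity.
Context {d} {Omega : measurableType d} {R : realType} (P : probability Omega R).
Variable X : R -> {RV P >-> R}.
Hypothesis hX : levy_process P X.
Variables (lambda mu : R) (e : {RV P >-> R}).
Hypotheses (lambda0 : 0 < lambda) (mu0 : 0 <= mu)
  (he : exponential_rv P e lambda) (heX : independent_of_process P e X).

Let path n w i := grid (X ^~ w) n i.

Let grid_max n w := path_max (path n w) (grid_index n (e w)).

Let S w := running_sup (X ^~ w) (e w).

Let discounted_value w t := expR (- lambda * t - mu * X t w).

Let expRmu_unit z : 0 <= z -> 0 <= expR (- mu * z) <= 1.
Proof.
by move=> z0; rewrite expR_ge0/= -expR0 ler_expR mulNr oppr_le0 mulr_ge0.
Qed.

Let measurable_process_max n k : measurable_fun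
  (setT : set (process_space X))
  (fun w => path_max (path n w) k).
Proof.
apply: (@measurable_path_max _ (process_space X)) => i _.
by apply: measurable_sigma_process; rewrite mulr_ge0// ltW// mesh_gt0.
Qed.

Let measurable_process_expR n k : measurable_fun
  (setT : set (process_space X))
  (fun w => expR (- mu * path_max (path n w) k)).
Proof. by apply: measurableT_comp => //; exact: measurable_funM. Qed.

Let q n := expR (- lambda * mesh n).

Let q_lt1 n : 0 < q n < 1.
Proof.
by rewrite expR_gt0/= -[ltRHS]expR0 ltr_expR mulNr oppr_lt0 mulr_gt0// mesh_gt0.
Qed.

Let first_value_discounted n y w :
  first_value (path n w) y (fun j => q n ^+ j * expR (- mu * path n w j)) =
  first_value (grid (X ^~ w) n) y (grid (discounted_value w) n).
Proof.
congr first_value; apply/funext => j.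
rewrite /grid /discounted_value /q -expRM_natl -expRD; congr expR.
by rewrite /path /grid; ring.
Qed.

(** The walk identity holds for the geometric law starting at 0; both of its series are rewritten
    through the index of [e], which starts at 1. *)
Lemma grid_identity n y : 0 <= y ->
  [/\ unit_valued (fun w => expR (- mu * grid_max n w)),
      unit_valued (fun w => (y < grid_max n w)%R%:R * expR (- mu * grid_max n w)),
      unit_valued (fun w => first_value (grid (X ^~ w) n) y
                              (grid (discounted_value w) n)) &
  q n * mean P (fun w => (y < grid_max n w)%R%:R * expR (- mu * grid_max n w)) =
  mean P (fun w => first_value (grid (X ^~ w) n) y (grid (discounted_value w) n)) *
  ((1 - q n) + q n * mean P (fun w => expR (- mu * grid_max n w)))].
Proof.
move=> y0.
have [] := @mean_exponential_time _ _ _ P X lambda e he heX n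
  (fun k w => expR (- mu * path_max (path n w) k)).
- by [].
- by move=> k w; apply: expRmu_unit; exact: path_max_ge0.
move=> ugamma /(@cvg_geometric_shift _ _ _
  (fun k => mean P (fun w => expR (- mu * path_max (path n w) k)))) cgamma.
have [] := @mean_exponential_time _ _ _ P X lambda e he heX n
  (fun k w => (y < path_max (path n w) k)%R%:R * expR (- mu * path_max (path n w) k)).
- move=> k; apply: measurable_funM => //; apply: measurable_nat_of_bool.
  by apply: measurable_fun_ltr.
- move=> k w; have /andP[e0 e1] := expRmu_unit (path_max_ge0 (path n w) k).
  by case: (y < _); rewrite ?mul1r ?e0// mul0r lexx ler01.
move=> ubeta /(@cvg_geometric_shift _ _ _ (fun k => mean P (fun w =>
  (y < path_max (path n w) k)%R%:R * expR (- mu * path_max (path n w) k)))) cbeta.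
have ualpha : unit_valued (fun w => first_value (path n w) y
    (fun j => q n ^+ j * expR (- mu * path n w j))).
  have /andP[q0 q1] := q_lt1 n.
  have [] := @cvg_mean_first_value _ _ _ P (path n) (measurable_levy_grid X n) y
    (fun w j => q n ^+ j * expR (- mu * path n w j)); last by [].
  - move=> j; apply: measurable_funM => //; apply: measurableT_comp => //.
    by apply: measurable_funM => //; exact: measurable_levy_grid.
  - move=> w j fj; have /andP[e0 e1] := first_passage_expR_unit y0 mu0 fj.
    by rewrite mulr_ge0 ?exprn_ge0 ?(ltW q0)//= mulr_ile1 ?exprn_ge0 ?exprn_ile1
      ?(ltW q0) ?(ltW q1).
split => //.
  by rewrite (_ : (fun w => _) = (fun w => first_value (path n w) y
    (fun j => q n ^+ j * expR (- mu * path n w j))))//;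
  apply/funext => w; rewrite first_value_discounted.
have := @cvg_mean_path_max _ _ _ P (path n) (levy_grid0 hX n)
  (measurable_levy_grid X n) (levy_grid_independent hX n)
  (levy_grid_stationary hX n) y mu (q n) _ y0 mu0 (q_lt1 n) cgamma.
move/(cvg_unique (@Rhausdorff R) cbeta).
have p0 w : path_max (path n w) 0 = 0.
  exact: path_max0 (levy_grid0 hX n w).
(* At index 0 the maximum is 0 <= y: the restricted term vanishes, and the other contributes 1 -
   q. *)
under [in X in mean P X]eq_fun do rewrite p0 ltNge y0 mul0r.
under [in X in _ * (_ * mean P X + _)]eq_fun do rewrite p0 mulr0 expR0.
rewrite !mean_cst mulr0 add0r mulr1 => ->.
by congr (mean P _ * _); apply/funext => w; rewrite first_value_discounted.
Qed.


Let cvg_grid_max w : grid_max n w @[n --> \oo] --> S w.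
Proof. exact: cvg_path_max_grid (levy_cadlag hX w) (levy_start0 hX w). Qed.

Let cvg_expR_grid_max w :
  expR (- mu * grid_max n w) @[n --> \oo] --> expR (- mu * S w).
Proof.
apply: (cvg_comp _ expR); last exact: continuous_expR.
by apply: cvgM => //; exact: cvg_cst.
Qed.

(** [mean_exponential_time] yields measurability for functions with values in [0, 1] only, so it is
    applied to exp(-M) and the maximum M is recovered by a logarithm. *)
Let measurable_grid_max n : measurable_fun setT (grid_max n).
Proof.
have [] := @mean_exponential_time _ _ _ P X lambda e he heX n
  (fun k w => expR (- path_max (path n w) k)).
- by move=> k; apply: measurableT_comp => //; exact: measurable_funN.
- move=> k w; rewrite expR_ge0/= -expR0 ler_expR oppr_le0.
  exact: path_max_ge0.
move=> [mexp _] _; have -> : grid_max n =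
    (fun w => - ln (expR (- path_max (path n w) (grid_index n (e w))))).
  by apply/funext => w; rewrite expRK opprK.
by apply: measurable_funN; apply: measurableT_comp => //; exact: measurable_ln.
Qed.

Lemma measurable_running_sup : measurable_fun setT S.
Proof.
apply: (measurable_fun_cvg measurable_grid_max) => w _; exact: cvg_grid_max.
Qed.

Lemma running_sup_ge0 w : 0 <= S w.
Proof.
have cS := @cvg_grid_max w; rewrite -(cvg_lim _ cS)//.
apply: limr_ge; first exact: cvgP cS.
by near=> n; exact: path_max_ge0.
Unshelve. all: by end_near. Qed.

Lemma unit_valued_expR_running_sup : unit_valued (fun w => expR (- mu * S w)).
Proof.
split; last by move=> w; apply: expRmu_unit; exact: running_sup_ge0.
apply: measurableT_comp => //; apply: measurable_funM => //.
exact: measurable_running_sup.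
Qed.

Lemma unit_valued_restrict (b : Omega -> bool) (f : Omega -> R) :
  measurable_fun setT b -> unit_valued f ->
  unit_valued (fun w => (b w)%:R * f w).
Proof.
move=> mb uf; apply: unit_valuedM => //; split.
  exact: measurable_nat_of_bool.
by move=> w; case: (b w); rewrite ?lexx ler01.
Qed.

Let cvg_q : q n @[n --> \oo] --> (1 : R).
Proof.
have -> : (1 : R) = expR (- lambda * 0) by rewrite mulr0 expR0.
apply: (cvg_comp _ expR); last exact: continuous_expR.
by apply: cvgM; [exact: cvg_cst|exact: cvg_mesh].
Qed.

Let cvg_discounted_value w t : 0 <= t ->
  discounted_value w s @[s --> t^'+] --> discounted_value w t.
Proof.
move=> t0; apply: (cvg_comp _ expR); last exact: continuous_expR.
apply: cvgB; apply: cvgM; try exact: cvg_cst.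
- exact: cvg_at_right_filter.
- exact: (levy_cadlag hX w).1.
Qed.


(* Two inequalities instead of an identity because S may have an atom at y. *)
Lemma levy_identity_bounds y : 0 <= y ->
  let alpha := mean P (fun w => at_exceed (X ^~ w) y (discounted_value w)) in
  let gamma := mean P (fun w => expR (- mu * S w)) in
  [/\ unit_valued (fun w => at_exceed (X ^~ w) y (discounted_value w)),
      mean P (fun w => (y < S w)%R%:R * expR (- mu * S w)) <= alpha * gamma &
      mean P (fun w => (S w < y)%R%:R * expR (- mu * S w)) <=
      gamma - alpha * gamma].
Proof.
move=> y0 alpha gamma.
have ids n := grid_identity n y0.
have [ualpha calpha] := @cvg_mean _ _ _ P
  (fun n w => first_value (grid (X ^~ w) n) y (grid (discounted_value w) n))
  (fun w => at_exceed (X ^~ w) y (discounted_value w))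
  (fun n => let: And4 _ _ u _ := ids n in u)
  (fun w => cvg_first_value_grid (levy_cadlag hX w) (@cvg_discounted_value w)).
have [ugamma cgamma] := @cvg_mean _ _ _ P _ _
  (fun n => let: And4 u _ _ _ := ids n in u) cvg_expR_grid_max.
pose beta n := mean P (fun w => (y < grid_max n w)%R%:R * expR (- mu * grid_max n w)).
(* The grid identity is divided by [q n], which tends to 1, so the summand 1 - q disappears. *)
have cbeta : beta n @[n --> \oo] --> alpha * gamma.
  have q0 n : q n != 0 by rewrite gt_eqF//; have /andP[] := q_lt1 n.
  have -> : beta = (fun n => (q n)^-1 *
      (mean P (fun w => first_value (grid (X ^~ w) n) y (grid (discounted_value w) n)) *
      ((1 - q n) + q n * mean P (fun w => expR (- mu * grid_max n w))))).
    by apply/funext => n; have [_ _ _ <-] := ids n; rewrite mulKf.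
  have -> : alpha * gamma = 1^-1 * (alpha * ((1 - 1) + 1 * gamma)).
    by rewrite invr1 subrr add0r !mul1r.
  apply: cvgM; first by apply: cvgV => //; exact: oner_neq0.
  apply: cvgM => //; apply: cvgD; last exact: cvgM.
  by apply: cvgB => //; exact: cvg_cst.
have mltS : measurable_fun setT (fun w => y < S w).
  by apply: measurable_fun_ltr => //; exact: measurable_running_sup.
have mSlt : measurable_fun setT (fun w => S w < y).
  by apply: measurable_fun_ltr => //; exact: measurable_running_sup.
have mltM n : measurable_fun setT (fun w => y < grid_max n w).
  exact: measurable_fun_ltr.
have uM n : unit_valued (fun w => expR (- mu * grid_max n w)) by have [] := ids n.
split => //.
  (* Where S > y the grid maximum eventually exceeds [y] too. The cut-off discards S = y, where the
     indicators need not converge, and keeps [f n] below the integrand of [beta n]. *)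
  pose f n w := (y < S w)%R%:R * ((y < grid_max n w)%R%:R * expR (- mu * grid_max n w)).
  have uf n : unit_valued (f n) by do 2 apply: unit_valued_restrict => //.
  have [] := @cvg_mean _ _ _ P f (fun w => (y < S w)%R%:R * expR (- mu * S w)) uf.
    move=> w; rewrite /f; have [yS|_] := ltP y (S w); last first.
      by rewrite mul0r; under eq_fun do rewrite mul0r; exact: cvg_cst.
    rewrite mul1r; under eq_fun do rewrite mul1r.
    apply: cvg_trans (@cvg_expR_grid_max w); apply: near_eq_cvg.
    near=> n; have -> : y < grid_max n w; last by rewrite mul1r.
    by near: n; have := @cvg_grid_max w; move/cvgr_gt; exact.
  move=> uflim cf; rewrite -(cvg_lim (@Rhausdorff R) cf).
  rewrite -(cvg_lim (@Rhausdorff R) cbeta).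
  apply: ler_lim; [exact: cvgP cf|exact: cvgP cbeta|].
  near=> n; apply: le_mean => //; first exact: unit_valued_restrict.
  move=> w; rewrite /f; case: (y < S w); rewrite ?mul1r// mul0r.
  by rewrite mulr_ge0 ?expR_ge0.
(* The complementary event is treated in the same way: [f n] plus the integrand of [beta n] is at
   most the integrand of the unrestricted mean. *)
pose f n w := (S w < y)%R%:R * ((grid_max n w <= y)%R%:R * expR (- mu * grid_max n w)).
have mMle n : measurable_fun setT (fun w => grid_max n w <= y).
  exact: measurable_fun_ler.
have uf n : unit_valued (f n) by do 2 apply: unit_valued_restrict => //.
have [] := @cvg_mean _ _ _ P f (fun w => (S w < y)%R%:R * expR (- mu * S w)) uf.
  move=> w; rewrite /f; have [yS|_] := ltP (S w) y; last first.
    by rewrite mul0r; under eq_fun do rewrite mul0r; exact: cvg_cst.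
  rewrite mul1r; under eq_fun do rewrite mul1r.
  apply: cvg_trans (@cvg_expR_grid_max w); apply: near_eq_cvg.
  near=> n; have -> : grid_max n w <= y; last by rewrite mul1r.
  by near: n; have := @cvg_grid_max w; move/cvgr_le; exact.
move=> uflim cf; rewrite -(cvg_lim (@Rhausdorff R) cf).
have cgb : mean P (fun w => expR (- mu * grid_max n w)) - beta n @[n --> \oo] -->
    gamma - alpha * gamma by exact: cvgB.
rewrite -(cvg_lim (@Rhausdorff R) cgb).
apply: ler_lim; [exact: cvgP cf|exact: cvgP cgb|].
near=> n; rewrite lerBrDr -meanD//; last first.
  exact: unit_valued_restrict.
apply: le_mean => //; last first.
  move=> w; rewrite /f; have [_|_] := leP (grid_max n w) y.
    rewrite mul1r mul0r addr0; case: (S w < y); rewrite ?mul1r// mul0r.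
    exact: expR_ge0.
  by rewrite mul1r mul0r mulr0 add0r.
split.
  by apply: measurable_funD; [exact: (uf n).1|exact: (unit_valued_restrict (mltM n) (uM n)).1].
move=> w; rewrite /f; have /andP[M0 M1] := (uM n).2 w.
have [_|_] := leP (grid_max n w) y.
  rewrite mul1r mul0r addr0; case: (S w < y); rewrite ?mul1r ?mul0r ?M0//.
  by rewrite lexx ler01.
by rewrite mul1r mul0r mulr0 add0r M0.
Unshelve. all: by end_near. Qed.

End levy_identity.

(** * Quasi-left-continuity at the hitting time *)

Lemma le_limn_einf (R : realType) (u : nat -> \bar R) (c : \bar R) k0 :
  (forall k, (k0 <= k)%N -> (c <= u k)%E) -> (c <= limn_einf u)%E.
Proof.
move=> cu; rewrite limn_einf_lim; apply: lime_ge; first exact: is_cvg_einfs.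
near=> n; apply: le_ereal_inf_tmp => _ [k /= nk <-]; apply: cu.
by rewrite (leq_trans _ nk)//; near: n; exact: nbhs_infty_ge.
Unshelve. all: by end_near. Qed.

Lemma limn_einf_le (R : realType) (u : nat -> \bar R) (c : \bar R) :
  (forall k, (u k <= c)%E) -> (limn_einf u <= c)%E.
Proof.
move=> uc; rewrite limn_einf_lim; apply: lime_le; first exact: is_cvg_einfs.
near=> n; apply: le_trans (uc n); apply: ereal_inf_lbound.
by exists n => //=.
Unshelve. all: by end_near. Qed.

Lemma measurable_fun_limn_einf d (T : measurableType d) (R : realType)
    (u : nat -> T -> \bar R) : (forall n, measurable_fun setT (u n)) ->
  measurable_fun setT (fun w => limn_einf (u ^~ w)).
Proof.
move=> mu; rewrite /limn_einf; apply: measurableT_comp => //.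
apply: (@measurable_fun_limn_esup _ _ _ _ (fun n => (\- (u n))%E)) => n.
exact: measurableT_comp.
Qed.

Lemma ge0_integral0_ae d (T : measurableType d) (R : realType)
    (P : probability T R) (f : T -> \bar R) : measurable_fun setT f ->
  (forall w, (0 <= f w)%E) -> (\int[P]_w f w <= 0)%E ->
  P [set w | f w != 0%E] = 0%E.
Proof.
move=> mf f0 intf.
have int0 : (\int[P]_w `|f w| = 0)%E.
  apply/eqP; rewrite eq_le integral_ge0// andbT.
  by under eq_integral do rewrite gee0_abs//.
have /(ae_eq_integral_abs P measurableT mf) [N [mN N0 fN]] := int0.
apply/eqP; rewrite eq_le measure_ge0 andbT -[X in (_ <= X)%E]N0.
apply: le_measure; rewrite ?inE//.
  rewrite -[X in measurable X]setTI; exact: emeasurable_neq.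
apply: subset_trans fN => w /= /eqP fw fw0; apply: fw.
exact: fw0.
Qed.

Section null_set.
Import HBNNSimple.

(* G itself need not be measurable: its integral is a supremum over simple
   functions below G, and each of them may be cut off outside N. *)
Lemma ge0_integral_setC_null d (T : measurableType d) (R : realType)
    (P : probability T R) (N : set T) (G : T -> R) :
  measurable N -> P N = 0%E -> (forall w, 0 <= G w) ->
  measurable_fun setT (fun w => \1_(~` N) w * G w) ->
  (\int[P]_w (G w)%:E = \int[P]_w (\1_(~` N) w * G w)%:E)%E.
Proof.
move=> mN N0 G0 mG.
have G10 w : (0 <= (\1_(~` N) w * G w)%:E)%E by rewrite lee_fin mulr_ge0.
have le1 w : (\1_(~` N) w <= 1 :> R) by rewrite indicE; case: (_ \in _).
apply/eqP; rewrite eq_le; apply/andP; split.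
  rewrite ge0_integralTE//.
  apply: ge_ereal_sup => _ [h /= hG <-]; rewrite -integralT_nnsfun.
  have m1 : measurable_fun setT (\1_(~` N) : T -> R).
    by apply: measurable_indic; exact: measurableC.
  have mh : measurable_fun setT (fun w => (\1_(~` N) w * h w)%:E).
    by apply/measurable_EFinP; apply: measurable_funM => //; exact: measurable_funPT.
  rewrite (@ge0_ae_eq_integral _ _ _ _ _ _ (fun w => (\1_(~` N) w * h w)%:E))//.
  - apply: ge0_le_integral => //.
    + by move=> w _; rewrite lee_fin mulr_ge0.
    + exact/measurable_EFinP.
    + by move=> w _; rewrite lee_fin ler_wpM2l// -lee_fin.
  - by apply/measurable_EFinP; exact: measurable_funPT.
  - by move=> w _; rewrite lee_fin.
  - by move=> w _; rewrite lee_fin mulr_ge0.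
  - exists N; split => // w /= hw; apply: contrapT => nw; apply: hw => _.
    by rewrite indicE mem_set// mul1r.
rewrite !ge0_integralTE//.
apply: ge_ereal_sup => _ [h /= hG <-]; apply: ereal_sup_ubound.
exists h => //= w; rewrite (le_trans (hG w))// lee_fin.
by rewrite ler_piMl.
Qed.

End null_set.

Section quasi_left_continuity.
Context {d} {Omega : measurableType d} {R : realType} (P : probability Omega R).
Variable X : R -> {RV P >-> R}.
Hypothesis hX : levy_process P X.
Variables (lambda x : R).
Hypothesis lambda0 : 0 < lambda.

Let jump j k w :=
  at_exceed (X ^~ w) (level x k) (discounted lambda (increment_size (X ^~ w) j)).

Let phi j := mean P (fun w => jump_size (X (mesh j) w)).

Lemma mesh_exp m n : (2 ^ m)%:R * mesh (m + n) = mesh n :> R.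
Proof. by rewrite /mesh exprD natrX mulrA -exprMn divff// expr1n mul1r. Qed.

Let cvg_discounted_increment j w t : 0 <= t ->
  discounted lambda (increment_size (X ^~ w) j) s @[s --> t^'+] -->
  discounted lambda (increment_size (X ^~ w) j) t.
Proof.
move=> t0; have [rX _] := levy_cadlag hX w.
apply: cvgM.
  apply: (cvg_comp _ expR); last exact: continuous_expR.
  by apply: cvgM; [exact: cvg_cst|exact: cvg_at_right_filter].
apply: (cvg_comp _ (@jump_size R)); last exact: continuous_jump_size.
apply: cvgB; last exact: rX.
apply/cvg_at_rightP => u [tu ut].
have /cvg_at_rightP := rX (t + mesh j) (addr_ge0 t0 (ltW (mesh_gt0 j))).
apply; split => [n|]; first by rewrite ltrD2r.
by apply: cvgD => //; exact: cvg_cst.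
Qed.

(** On the grid of level n + j the time [mesh j] is exactly 2^n steps, so the random walk bound
    applies with a right-hand side free of n; then n goes to infinity. *)
Lemma mean_jump_le j k : unit_valued (jump j k) /\ mean P (jump j k) <= phi j.
Proof.
pose p n w i := grid (X ^~ w) n i.
pose v n w := first_value (p (n + j)%N w) (level x k)
  (grid (discounted lambda (increment_size (X ^~ w) j)) (n + j)).
have h n : unit_valued (v n) /\ mean P (v n) <= phi j.
  have q01 : 0 <= expR (- lambda * mesh (n + j)) <= 1.
    rewrite expR_ge0/= -expR0 ler_expR mulNr oppr_le0.
    by rewrite mulr_ge0 ?(ltW lambda0)// ltW// mesh_gt0.
  have := @mean_increment_after_first_passage _ _ _ P (p (n + j)%N)
    (levy_grid0 hX (n + j)) (measurable_levy_grid X (n + j))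
    (levy_grid_independent hX (n + j)) (levy_grid_stationary hX (n + j))
    (level x k) _ (2 ^ n)%N (@jump_size R) q01 _ (@jump_size_bounds R).
  have -> : (fun w => first_value (p (n + j)%N w) (level x k)
      (fun i => expR (- lambda * mesh (n + j)) ^+ i *
        jump_size (p (n + j)%N w (i + 2 ^ n)%N - p (n + j)%N w i))) = v n.
    apply/funext => w; congr first_value; apply/funext => i.
    rewrite /p /grid /discounted /increment_size natrD mulrDl mesh_exp.
    by congr (_ * _); rewrite -expRM_natl; congr expR; ring.
  rewrite /phi /p /grid mesh_exp; apply.
  by apply: continuous_measurable_fun; exact: continuous_jump_size.
have cv w : v n w @[n --> \oo] --> jump j k w.
  have := cvg_first_value_grid (y := level x k) (levy_cadlag hX w)
    (@cvg_discounted_increment j w).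
  by rewrite -(cvg_shiftn j).
have [uj cj] := @cvg_mean _ _ _ P v (jump j k) (fun n => (h n).1) cv.
split => //; rewrite -(cvg_lim (@Rhausdorff R) cj).
apply: limr_le; first exact: cvgP cj.
by near=> n; exact: (h n).2.
Unshelve. all: by end_near. Qed.

Let cvg_phi : phi j @[j --> \oo] --> (0 : R).
Proof.
have [|w|_ c] := @cvg_mean _ _ _ P (fun j w => jump_size (X (mesh j) w)) (cst 0).
- move=> j; split; last by move=> w; exact: jump_size_bounds.
  apply: measurableT_comp => //.
  by apply: continuous_measurable_fun; exact: continuous_jump_size.
- have -> : cst 0 w = jump_size (X 0 w).
    by rewrite (levy_start0 hX) /jump_size normr0 oppr0 expR0 subrr.
  apply: (cvg_comp _ (@jump_size R)); last exact: continuous_jump_size.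
  have [rX _] := levy_cadlag hX w.
  have /cvg_at_rightP := rX 0 (lexx 0); apply; split.
    exact: mesh_gt0.
  exact: cvg_mesh.
by rewrite mean_cst in c.
Qed.

(** Let [Zoo] be the iterated lower limit of [jump j k], in k and then in j. Fatou's lemma, used
    twice, bounds its mean by the limit 0 of [phi], so [Zoo] vanishes off a null set, whereas a jump
    would keep it above a positive constant. *)
Lemma ae_no_jump : exists N : set Omega,
  [/\ measurable N, P N = 0%E & forall w, ~ N w -> ~ jumps_at_level (X ^~ w) x lambda].
Proof.
pose Z j w : \bar R := limn_einf (fun k => (jump j k w)%:E).
pose Zoo w : \bar R := limn_einf (fun j => Z j w).
have mjump j k : measurable_fun setT (fun w => (jump j k w)%:E).
  by apply/measurable_EFinP; exact: (mean_jump_le j k).1.1.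
have mZ j : measurable_fun setT (Z j).
  exact: measurable_fun_limn_einf.
have mZoo : measurable_fun setT Zoo by exact: measurable_fun_limn_einf.
have jump0 j k w : 0 <= jump j k w by have /andP[] := (mean_jump_le j k).1.2 w.
have Z0 j w : (0 <= Z j w)%E.
  by apply: (@le_limn_einf _ _ _ 0) => k _; rewrite lee_fin.
have Zoo0 w : (0 <= Zoo w)%E by apply: (@le_limn_einf _ _ _ 0) => j _.
have intZ j : (\int[P]_w Z j w <= (phi j)%:E)%E.
  apply: le_trans (fatou P measurableT _ _) _ => //.
    by move=> k w _; rewrite lee_fin.
  apply: limn_einf_le => k; have [uj] := mean_jump_le j k.
  by rewrite -lee_fin -meanE// unlock.
have intZoo : (\int[P]_w Zoo w <= 0)%E.
  apply: le_trans (fatou P measurableT _ _) _ => //.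
  have c0 : (fun j => (phi j)%:E) @ \oo --> (0 : R)%:E.
    by apply: cvg_EFin; [near=> j|exact: cvg_phi].
  rewrite -[leRHS](cvg_lim _ c0)// -is_cvg_limn_einfE; last exact: cvgP c0.
  rewrite !limn_einf_lim; apply: lee_lim; [exact: is_cvg_einfs|exact: is_cvg_einfs|].
  near=> n; apply: le_ereal_inf_tmp => _ [k /= nk <-].
  by apply: le_trans (intZ k); apply: ereal_inf_lbound; exists k.
exists [set w | Zoo w != 0%E]; split.
- by rewrite -[X in measurable X]setTI; exact: emeasurable_neq.
- exact: ge0_integral0_ae.
move=> w /= /negP; rewrite negbK => /eqP Zw [c c0 [j0 hj]].
have : (c%:E <= Zoo w)%E.
  apply: (@le_limn_einf _ _ _ j0) => j /hj[k0 hk].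
  by apply: (@le_limn_einf _ _ _ k0) => k /hk; rewrite lee_fin.
by rewrite Zw lee_fin leNgt c0.
Unshelve. all: by end_near. Qed.

End quasi_left_continuity.

(** * Passage from the levels below x to x itself *)

Theorem theorem3 (R : realType) (d : measure_display) (Omega : measurableType d)
    (P : probability Omega R) (X : R -> {RV P >-> R}) (hX : levy_process P X)
    (lambda mu x : R) (hlambda : 0 < lambda) (hmu : 0 < mu) (hx : 0 < x)
    (e : {RV P >-> R}) (he : exponential_rv P e lambda)
    (heX : independent_of_process P e X) :
  let S := fun w : Omega => running_sup (X ^~ w) (e w) in
  ('E_P[(fun w => if hitting_time (X ^~ w) x is t%:E
                  then expR (- lambda * t - mu * X t w) else 0)%R]
   = 'E_P[(fun w => expR (- mu * S w) * \1_[set w' | x <= S w'] w)%R]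
     / 'E_P[(fun w => expR (- mu * S w))%R])%E.
Proof.
move=> S; set G := (G in 'E_P[G]%E = _).
have mu0 := ltW hmu.
have [N [mN N0 nojump]] := ae_no_jump hX x hlambda.
pose A k w := at_exceed (X ^~ w) (level x k)
  (fun t => expR (- lambda * t - mu * X t w)).
have bounds k := levy_identity_bounds hX hlambda mu0 he heX (level_ge0 k hx).
have uA k : unit_valued (A k) by have [] := bounds k.
have uS : unit_valued (fun w => expR (- mu * S w)).
  exact: (unit_valued_expR_running_sup hX mu0 he heX).
have mS : measurable_fun setT S by exact: (measurable_running_sup hX he heX).
set gamma := mean P (fun w => expR (- mu * S w)).
pose rho := mean P (fun w => (x <= S w)%R%:R * expR (- mu * S w)).
have uN : unit_valued (\1_(~` N) : Omega -> R).
  split; first by apply: measurable_indic; exact: measurableC.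
  by move=> w; rewrite indicE; case: (_ \in _); rewrite ?lexx ler01.
(* Pathwise convergence is known off [N] only; the indicator makes it hold everywhere and makes the
   limit measurable. *)
have A_G w : \1_(~` N) w * A k w @[k --> \oo] --> \1_(~` N) w * G w.
  have [Nw|nNw] := pselect (N w).
    rewrite indicE memNset; last by move=> /(_ Nw).
    by rewrite mul0r; under eq_fun do rewrite mul0r; exact: cvg_cst.
  apply: cvgM; first exact: cvg_cst.
  exact: (cvg_at_exceed_level (levy_cadlag hX w) (levy_start0 hX w) hx hlambda mu0
    (nojump w nNw)).
have [uG cG] := @cvg_mean _ _ _ P (fun k w => \1_(~` N) w * A k w) _
  (fun k => unit_valuedM uN (uA k)) A_G.
pose a := mean P (fun w => \1_(~` N) w * G w).
have cA : mean P (A k) @[k --> \oo] --> a.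
  rewrite (_ : (fun k => mean P (A k)) = fun k => mean P (fun w => \1_(~` N) w * A k w))//.
  apply/funext => k; rewrite /mean unlock; congr fine.
  apply: ge0_integral_setC_null => //.
  - by move=> w; have /andP[] := (uA k).2 w.
  - exact: (unit_valuedM uN (uA k)).1.
have urho : unit_valued (fun w => (x <= S w)%R%:R * expR (- mu * S w)).
  by apply: unit_valued_restrict => //; exact: measurable_fun_ler.
have ult (y : R) : unit_valued (fun w => (S w < y)%R%:R * expR (- mu * S w)).
  by apply: unit_valued_restrict => //; exact: measurable_fun_ltr.
(* Since [level x k] < x, the event S >= x is contained in S > [level x k], and the first bound at
   each level passes to the limit. *)
have rho_le : rho <= a * gamma.
  have cAg : mean P (A k) * gamma @[k --> \oo] --> a * gamma.
    by apply: cvgM => //; exact: cvg_cst.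
  rewrite -(cvg_lim (@Rhausdorff R) cAg); apply: limr_ge; first exact: cvgP cAg.
  near=> k; have [_ + _] := bounds k; apply: le_trans; apply: le_mean => //.
    by apply: unit_valued_restrict => //; exact: measurable_fun_ltr.
  move=> w; rewrite ler_wpM2r ?expR_ge0// ler_nat.
  case: (leP x (S w)) => // xS.
  by rewrite (lt_le_trans (level_lt k hx) xS).
(* The events S < [level x k] increase to S < x, an atom of S at [x] being excluded from all of
   them; the second bound gives the reverse inequality. *)
have le_rho : gamma - rho <= gamma - a * gamma.
  have cAg : gamma - mean P (A k) * gamma @[k --> \oo] --> gamma - a * gamma.
    by apply: cvgB; [exact: cvg_cst|apply: cvgM => //; exact: cvg_cst].
  have [|_ clt] := @cvg_mean _ _ _ P
    (fun k w => (S w < level x k)%R%:R * expR (- mu * S w))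
    (fun w => (S w < x)%R%:R * expR (- mu * S w)) (fun k => ult _).
    move=> w; apply: cvgM; last exact: cvg_cst.
    apply: cvg_near_cst; have [Sx|xS] := ltP (S w) x.
      near=> k; have -> // : S w < level x k.
      by near: k; have := @cvg_level _ x; move/cvgr_gt; exact.
    by near=> k; rewrite ltNge (le_trans (ltW (level_lt k hx)) xS).
  have -> : gamma - rho = mean P (fun w => (S w < x)%R%:R * expR (- mu * S w)).
    apply/eqP; rewrite subr_eq -meanD//; apply/eqP; congr (mean P _).
    apply/funext => w; case: (ltP (S w) x) => _; first by rewrite mul1r mul0r addr0.
    by rewrite mul1r mul0r add0r.
  rewrite -(cvg_lim (@Rhausdorff R) clt) -(cvg_lim (@Rhausdorff R) cAg).
  apply: ler_lim; [exact: cvgP clt|exact: cvgP cAg|].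
  by near=> k; have [_ _] := bounds k.
have gamma0 : gamma != 0.
  apply/eqP => g0.
  have := @ge0_integral0_ae _ _ _ P (fun w => (expR (- mu * S w))%:E).
  rewrite (_ : [set w | _] = setT) ?probability_setT; last first.
    by apply/seteqP; split => // w _ /=; rewrite eqe gt_eqF// expR_gt0.
  have := meanE P uS; rewrite -/gamma g0 unlock => -> h.
  have /eqP : (1 : \bar R)%E = 0%E.
    by apply: h => //; apply/measurable_EFinP; exact: uS.1.
  by rewrite eqe oner_eq0.
(* [G] may fail to be measurable on [N]; its integral is that of the measurable function cut off
   there. *)
have -> : 'E_P[G]%E = a%:E.
  rewrite -meanE// unlock; apply: ge0_integral_setC_null => //; last exact: uG.1.
  by move=> w; rewrite /G; case: hitting_time => // t; exact: expR_ge0.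
have -> : (fun w => expR (- mu * S w) * \1_[set w' | x <= S w'] w) =
    (fun w => (x <= S w)%R%:R * expR (- mu * S w)).
  apply/funext => w; rewrite mulrC indicE; congr (_%:R * _).
  by congr nat_of_bool; apply/idP/idP; rewrite inE.
rewrite !meanE// -/gamma -/rho inver (negbTE gamma0) -EFinM; congr EFin.
have -> : rho = a * gamma by lra.
by rewrite mulfK.
Unshelve. all: by end_near. Qed.
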